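(* Let $\Gamma$ be a polyhedral group, $S$ one of its orbits on the sphere, $P$ a relatively invariant form of degree $|\Gamma|$ vanishing on $S$, and $R=\mathbb{C}[X,Y,P^{-1}]$. Then for all $k\in\mathbb{Z}$, $$R^{B\Gamma}_k=R^{\Gamma}_0\,P_k ,$$ where $P_k=0$ for $k$ odd and, for $k$ even, $$P_k=P^{\ell}\prod_{i\in\Omega}P_i^{\mathsf{n}(k)_i},\qquad \ell=\frac{k-\sum_{i\in\Omega}\mathsf{n}(k)_i d_i}{|\Gamma|}.$$
   Context: $\Gamma\subset \mathrm{SO}(3)$ is a polyhedral group, i.e. a finite subgroup, and $B\Gamma\subset\mathrm{SU}(2)$ is its full preimage under the double cover $\mathrm{SU}(2)\to\mathrm{SO}(3)$; so $-\mathrm{Id}\in B\Gamma$ and $\Gamma\cong B\Gamma/\{\pm\mathrm{Id}\}$. The group $\Gamma$ acts on the Riemann sphere, identified with the complex projective line of lines in $\mathbb{C}^2$. $\Omega$ is an index set for the $\Gamma$-orbits $S_i$ ($i\in\Omega$) on the sphere whose elements have nontrivial stabiliser; $d_i=|S_i|$ and $\nu_i$ is the order of the stabiliser of an element of $S_i$, so $d_i\nu_i=|\Gamma|$. The ground form $P_i\in\mathbb{C}[X,Y]$ is a homogeneous polynomial of degree $d_i$ vanishing on (the lines corresponding to) $S_i$, unique up to a nonzero scalar. $B\Gamma$ acts on $\mathbb{C}[X,Y]$ by $(\gamma f)(v)=f(\gamma^{-1}v)$, $v=(X,Y)^T$. A form (homogeneous polynomial) is relatively invariant if each $\gamma\in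 B\Gamma$ multiplies it by a scalar. For any orbit $S$ (exceptional or not) the relatively invariant form $P$ of degree $|\Gamma|$ whose zero set is $S$ is unique up to a nonzero scalar (it is proportional to $P_i^{\nu_i}$ when $S=S_i$). $R_k$ is the subspace of $R$ of elements of homogeneous degree $k\in\mathbb{Z}$, and $R_k^{B\Gamma}$ its invariants; for $k$ even the action factors through $\Gamma$ and one writes $R_k^\Gamma$. The map $\mathsf{n}:2\mathbb{Z}\to\prod_{i\in\Omega}\{0,\ldots,\nu_i-1\}$ is given by: $\mathsf{n}(k)_i$ is the residue of $k/2$ modulo $\nu_i$. *)

(* Defs.v *)
From HB Require Import structures.
From mathcomp Require Import all_boot all_order all_algebra.
From mathcomp Require Import generic_quotient finmap mpoly complex reals ring.

Set Implicit Arguments.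
Unset Strict Implicit.
Unset Printing Implicit Defensive.

Import Order.TTheory GRing.Theory Num.Theory.

Local Open Scope fset_scope.
Local Open Scope quotient_scope.
Local Open Scope sesquilinear_scope.
Local Open Scope ring_scope.

Notation "f %:F" := (@FracField.tofrac _ f) : ring_scope.

Lemma frac_repr (A : idomainType) (x : {fraction A}) :
  x = (\n_(repr x))%:F / (\d_(repr x))%:F.
Proof.
have d0 : \d_(repr x) != 0 by exact: denom_ratioP.
have pF (a : A) : a%:F = \pi_(FracField.type A) (Ratio a 1)
  by rewrite /FracField.tofrac; unlock.
rewrite !pF.
have pV r : (\pi_(FracField.type A) r)^-1 = \pi_(FracField.type A) (FracField.invf r).
  by rewrite FracField.pi_inv.
have pM r s : \pi_(FracField.type A) r * \pi_(FracField.type A) s =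
    \pi_(FracField.type A) (FracField.mulf r s).
  by rewrite FracField.pi_mul.
rewrite pV pM.
rewrite /FracField.mulf /FracField.invf !numden_Ratio ?oner_eq0 //.
by rewrite mulr1 mul1r FracField.Ratio_numden reprK.
Qed.

Lemma frac_eq (A : idomainType) (n d f h : A) : d != 0 -> h != 0 ->
  n * h = f * d -> n%:F / d%:F = f%:F / h%:F.
Proof.
move=> d0 h0 E; apply/eqP.
by rewrite eqr_div ?tofrac_eq0 // -!tofracM tofrac_eq E.
Qed.

Lemma frac_cross (A : idomainType) (f h : A) : h != 0 ->
  \n_(repr (f%:F / h%:F)) * h = f * \d_(repr (f%:F / h%:F)).
Proof.
move=> h0; have := frac_repr (f%:F / h%:F); set x := repr _ => /eqP.
rewrite eqr_div ?tofrac_eq0 ?denom_ratioP // -!rmorphM tofrac_eq => /eqP.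
by move=> E; rewrite E.
Qed.

Lemma comp_mpolyK (A : comNzRingType) n (s t : n.-tuple {mpoly A[n]}) :
    (forall i, ('X_i \mPo s) \mPo t = 'X_i) ->
  cancel (fun f => f \mPo s) (fun f => f \mPo t).
Proof.
move=> st; elim/mpolyind => [|c m p _ _ IH]; first by rewrite !rmorph0.
rewrite !linearD /= IH; congr (_ + _).
rewrite !linearZ /=; congr (_ *: _).
rewrite mpolyXE_id !rmorph_prod; apply: eq_bigr => i _.
by rewrite /= !rmorphXn /= st.
Qed.

Section Defs.
Variable R : realType.
Notation C := R[i].
Notation "C[X,Y]" := {mpoly C[2]} (at level 0).
Notation "C(X,Y)" := {fraction {mpoly C[2]}} (at level 0).

Definition SO3 := [qualify A : 'M[R]_3 | (A *m A^T == 1%:M) && (\det A == 1)].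

Definition SU2 := [qualify g : 'M[C]_2 | (g \is unitarymx) && (\det g == 1)].

Definition polyhedral (Gamma : {fset 'M[R]_3}) : Prop :=
  [/\ {in Gamma, forall A, A \is SO3},
      1%:M \in Gamma,
      {in Gamma &, forall A B, A *m B \in Gamma} &
      {in Gamma, forall A, invmx A \in Gamma}].

Definition mx2 (a b c d : C) : 'M[C]_2 :=
  \matrix_(i, j) nth 0 (nth [::] [:: [:: a; b]; [:: c; d]] i) j.

Definition pauli (k : 'I_3) : 'M[C]_2 :=
  nth 0 [:: mx2 0 1 1 0; mx2 0 (- 'i%C) 'i%C 0; mx2 1 0 0 (- 1)] k.

(* The double cover: g in SU(2) acts by conjugation on the traceless Hermitian
   matrices, and this is its matrix in the basis of Pauli matrices, which is
   orthogonal for <M, N> = tr (M N) / 2.  The trace is real; Re only casts it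
   to R. *)
Definition SU2_to_SO3 (g : 'M[C]_2) : 'M[R]_3 :=
  \matrix_(i, j) complex.Re (\tr (pauli i *m g *m pauli j *m g^t*) / 2).

Definition binary (Gamma : {fset 'M[R]_3}) :=
  [qualify g : 'M[C]_2 | (g \is SU2) && (SU2_to_SO3 g \in Gamma)].

Definition on_sphere (x : 'cV[R]_3) : bool := x^T *m x == 1%:M.

(* The identification of the projective line with the unit sphere: the line
   spanned by v goes to the unit vector of components v^* sigma_i v / v^* v.
   It intertwines g in SU(2) with the rotation SU2_to_SO3 g (bloch_act). *)
Definition bloch (v : 'cV[C]_2) : 'cV[R]_3 :=
  \col_i complex.Re ((v^t* *m pauli i *m v) 0 0 / (v^t* *m v) 0 0).

Section Orbits.
Variable Gamma : {fset 'M[R]_3}.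

Definition sphere_orbit (x : 'cV[R]_3) : {fset 'cV[R]_3} :=
  [fset A *m x | A in Gamma].

Definition stabiliser (x : 'cV[R]_3) : {fset 'M[R]_3} :=
  [fset A in Gamma | A *m x == x].

Definition is_orbit (S : {fset 'cV[R]_3}) : Prop :=
  exists2 x, on_sphere x & S = sphere_orbit x.

Definition is_exceptional_orbit (S : {fset 'cV[R]_3}) : Prop :=
  exists x, [/\ on_sphere x, S = sphere_orbit x & stabiliser x != [fset 1%:M]].

End Orbits.

Definition vanishes_at (f : C[X,Y]) (v : 'cV[C]_2) : Prop :=
  f.@[fun i => v i 0] = 0.

Definition is_ground_form (S : {fset 'cV[R]_3}) (f : C[X,Y]) : Prop :=
  [/\ f != 0, f \is #|` S|.-homog &
      forall v, v != 0 -> bloch v \in S -> vanishes_at f v].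

(* (g f)(v) = f (g^-1 v) *)
Definition act (g : 'M[C]_2) (f : C[X,Y]) : C[X,Y] :=
  f \mPo [tuple \sum_(j < 2) invmx g i j *: 'X_j | i < 2].

(* The extension of act g to fractions; it does not depend on the chosen
   representative (frac_act_frac). *)
Definition frac_act (g : 'M[C]_2) (x : C(X,Y)) : C(X,Y) :=
  (act g \n_(repr x))%:F / (act g \d_(repr x))%:F.

Definition relatively_invariant (Gamma : {fset 'M[R]_3}) (f : C[X,Y]) : Prop :=
  forall g, g \is binary Gamma -> exists c : C, act g f = c *: f.

Definition has_zero_set (S : {fset 'cV[R]_3}) (f : C[X,Y]) : Prop :=
  forall v, v != 0 -> (vanishes_at f v <-> bloch v \in S).

(* The homogeneous part of degree k of C[X,Y,P^-1], as a subset of C(X,Y), for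
   P a nonzero form. *)
Definition localized_part (P : C[X,Y]) (k : int) (x : C(X,Y)) : Prop :=
  exists f m d e, [/\ f \is d.-homog, P ^+ m \is e.-homog,
                      d%:Z - e%:Z = k & x = f%:F / (P ^+ m)%:F].

(* For k even, - 1 acts trivially in degree k, and these are the invariants of
   Gamma. *)
Definition invariant_part (Gamma : {fset 'M[R]_3}) (P : C[X,Y]) (k : int)
    (x : C(X,Y)) : Prop :=
  localized_part P k x /\ forall g, g \is binary Gamma -> frac_act g x = x.

(* The residue of k/2 modulo nu, for k even; k may be negative. *)
Definition half_residue (nu : nat) (k : int) : nat :=
  `|((k %/ 2)%Z %% nu%:Z)%Z|%N.

Section InvariantElement.
Variables (Gamma : {fset 'M[R]_3}) (Omega : finType).
Variables (So : Omega -> {fset 'cV[R]_3}) (nu : Omega -> nat).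
Variables (Po : Omega -> C[X,Y]) (P : C[X,Y]).

(* k - \sum_i n(k)_i d_i *)
Definition residual_degree (k : int) : int :=
  k - \sum_(i : Omega) (half_residue (nu i) k * #|` So i|)%:Z.

Definition P_elt (k : int) : C(X,Y) :=
  if (2 %| k)%Z then
    P%:F ^ (residual_degree k %/ #|` Gamma|%:Z)%Z
      * \prod_(i : Omega) (Po i)%:F ^+ half_residue (nu i) k
  else 0.

End InvariantElement.

Lemma act_mul (g : 'M[C]_2) : {morph act g : f h / f * h}.
Proof. by move=> f h; rewrite /act rmorphM. Qed.

Lemma act_var (g : 'M[C]_2) i : act g 'X_i = \sum_(j < 2) invmx g i j *: 'X_j.
Proof. by rewrite /act comp_mpolyXU -tnth_nth tnth_mktuple. Qed.

Lemma actV_var (g : 'M[C]_2) : g \in unitmx -> forall i,  act (invmx g) (act g 'X_i) = 'X_i.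
Proof. move=> gU i; rewrite act_var {1}/act linear_sum /=.
have E j : (invmx g i j *: 'X_j) \mPo [tuple \sum_(j0 < 2) invmx (invmx g) i0 j0 *: 'X_j0 | i0 < 2]
     = \sum_k (invmx g i j * g j k) *: 'X_k.
  rewrite linearZ /= -[_ \mPo _]/(act (invmx g) 'X_j).
  rewrite act_var invmxK scaler_sumr.
  by apply: eq_bigr => k _; rewrite scalerA.
under eq_bigr => j _ do rewrite E.
rewrite exchange_big /=.
under eq_bigr => k _.
  rewrite -scaler_suml; over.
rewrite (bigD1 i) //= [X in _ + X]big1 ?addr0.
  have := congr1 (fun M : 'M_2 => M i i) (mulVmx gU).
  by rewrite !mxE eqxx => ->; rewrite scale1r.
move=> k ki; have := congr1 (fun M : 'M_2 => M i k) (mulVmx gU).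
by rewrite !mxE eq_sym (negPf ki) => ->; rewrite scale0r.
Qed.

Lemma actK (g : 'M[C]_2) : g \in unitmx -> cancel (act g) (act (invmx g)).
Proof.
by move=> gU; apply: comp_mpolyK => i; exact: actV_var.
Qed.

Lemma act_eq0 (g : 'M[C]_2) f : g \in unitmx -> (act g f == 0) = (f == 0).
Proof.
move=> gU; have a0 : act g 0 = 0 by rewrite /act rmorph0.
by rewrite -{1}a0 (inj_eq (can_inj (actK gU))).
Qed.

Lemma frac_act_frac (g : 'M[C]_2) (f h : C[X,Y]) : g \in unitmx -> h != 0 ->
  frac_act g (f%:F / h%:F) = (act g f)%:F / (act g h)%:F.
Proof.
move=> gU h0; rewrite /frac_act; set x := repr _.
have d0 : act g \d_x != 0 by rewrite act_eq0 ?denom_ratioP.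
have h0' : act g h != 0 by rewrite act_eq0.
apply: (frac_eq d0 h0').
by have := congr1 (act g) (frac_cross f h0); rewrite 2!act_mul.
Qed.

Lemma pauli_expand (M : 'M[C]_2) : \tr M = 0 ->
  M = \sum_j (\tr (M *m pauli j) / 2) *: pauli j.
Proof.
have trE (N : 'M[C]_2) : \tr N = N 0 0 + N 1 1.
  by rewrite /mxtrace !big_ord_recl big_ord0 addr0; congr (_ + N _ _); apply: val_inj.
have mE (N N' : 'M[C]_2) i j : (N *m N') i j = N i 0 * N' 0 j + N i 1 * N' 1 j.
  rewrite mxE !big_ord_recl big_ord0 addr0.
  by congr (_ + N _ _ * N' _ _); apply: val_inj.
rewrite trE => /eqP; rewrite addr_eq0 => /eqP m0.
have i2 : 'i%C * 'i%C = -1 :> C by rewrite -expr2 sqr_i.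
have n2 : 2 != 0 :> C by rewrite pnatr_eq0.
have ord2 (i : 'I_2) : i = 0 \/ i = 1.
  by case: i => [[|[|//]]] Hi; [left|right]; apply: val_inj.
apply/matrixP => i j.
rewrite !big_ord_recl big_ord0 addr0 !trE !mE !mxE /= m0.
by case: (ord2 i) => ->; case: (ord2 j) => -> /=; rewrite ?m0; field: i2.
Qed.

Lemma bloch_act (g : 'M[C]_2) v : g \is SU2 ->
  bloch (g *m v) = SU2_to_SO3 g *m bloch v.
Proof.
case/andP=> gU /eqP detg; apply/colP=> i; rewrite [LHS]mxE [RHS]mxE.
have gg : g *m g^t* = 1%:M by apply/unitarymxP.
have gg' : g^t* *m g = 1%:M by apply: mulmx1C.
have cj m n p (A : 'M[C]_(m, n)) (B : 'M[C]_(n, p)) : (A *m B)^t* = B^t* *m A^t*.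
  by rewrite trmx_mul map_mxM.
have N : (g *m v)^t* *m (g *m v) = v^t* *m v.
  by rewrite cj -mulmxA (mulmxA _ g) gg' mul1mx.
rewrite N.
have rD : {morph (@complex.Re R) : x y / x + y} by case=> a b [c d].
have rM (a b : C) : complex.Im b = 0 -> complex.Re (a * b) = complex.Re a * complex.Re b.
  case: a b => [a a'] [b b'] /= ->; change (a * b - a' * 0 = a * b).
  by rewrite mulr0 subr0.
have hP j : (pauli j)^t* = pauli j.
  case: j => [[|[|[|//]]]] Hj; apply/matrixP=> a b; rewrite !mxE;
  case: a => [[|[|//]]] Ha; case: b => [[|[|//]]] Hb /=;
  rewrite ?rmorph0 ?rmorph1 ?rmorphN ?rmorph1 //; apply/eqP; rewrite eq_complex /= ?oppr0 ?opprK ?eqxx //.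
have real1 (A : 'M[C]_1) : A^t* = A -> complex.Im (A 0 0) = 0.
  move=> /matrixP/(_ 0 0); rewrite !mxE; case: (A 0 0) => a b /= [] /eqP.
  by rewrite -subr_eq0 -opprD oppr_eq0 -mulr2n mulrn_eq0 /= => /eqP.
have hr j : complex.Im ((v^t* *m pauli j *m v) 0 0 / (v^t* *m v) 0 0) = 0.
  have h1 : complex.Im ((v^t* *m pauli j *m v) 0 0) = 0.
    by apply: real1; rewrite !cj hP trmxCK mulmxA.
  have h2 : complex.Im ((v^t* *m v) 0 0) = 0.
    by apply: real1; rewrite !cj trmxCK.
  have rc (z : C) : complex.Im z = 0 -> z = real_complex R (complex.Re z).
    by case: z => x y /= ->.
  by rewrite (rc _ h1) (rc _ h2) -fmorph_div.
under [RHS]eq_bigr => j _ do rewrite [SU2_to_SO3 _ _ _]mxE [bloch _ _ _]mxE -rM //.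
have r0 : complex.Re (0 : C) = 0 by [].
rewrite -(big_morph _ rD r0); congr complex.Re.
under eq_bigr => j _ do rewrite mulrA.
rewrite -mulr_suml; congr (_ / _).
have -> : (g *m v)^t* *m pauli i *m (g *m v) = v^t* *m (g^t* *m pauli i *m g) *m v.
  by rewrite cj !mulmxA.
rewrite [X in _ *m X *m _]pauli_expand; last first.
  rewrite mxtrace_mulC mulmxA gg mul1mx /mxtrace !big_ord_recl big_ord0.
  by case: i => [[|[|[|//]]]] Hi; rewrite !mxE /= ?addr0 ?subrr.
rewrite mulmx_sumr mulmx_suml summxE; apply: eq_bigr => j _.
rewrite -scalemxAr -scalemxAl mxE; congr (_ / _ * _).
by rewrite -!mulmxA mxtrace_mulC !mulmxA.
Qed.

End Defs.

(* Main.v *)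
Require Import Defs.
From HB Require Import structures.
From mathcomp Require Import all_boot all_order all_algebra.
From mathcomp Require Import generic_quotient finmap mpoly complex reals.
From mathcomp Require Import ring lra.

Import Order.TTheory GRing.Theory Num.Theory.
Local Open Scope fset_scope.
Local Open Scope sesquilinear_scope.
Local Open Scope ring_scope.

(** A nonzero binary form splits into linear forms, so up to a scalar it is
    determined by its divisor, the multiset of its zeros on the sphere
    ([divisor_exists], [divisor_unique]), and one form divides another as soon
    as its multiplicities are no larger ([divisor_dvd]).  Everything about
    invariance can be read on divisors, as follows.

    Let [g] in the binary group have the line of the point [p] as an eigenline,
    with eigenvalue [z].  If [g] multiplies a form of degree [d], vanishing to
    order [c] at [p], by the scalar [chi], then [chi z^d = z^(2c)]
    ([semi_inv_character]): split off the [c] factors vanishing at [p], each of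
    which is multiplied by [z], and evaluate the other factor at [p].  The
    square [z^2] encodes the angle of the rotation of [g] about [p]
    ([angle_eigen]), and the angles of the stabiliser of [p] are all the
    [nu]-th roots of unity, [nu] being the order of the stabiliser
    ([angle_unity], [stabiliser_prim_angle]).

    By the orbit-stabiliser formula, the multiplicities of [P] are multiples of
    [nu] ([P_divisor]), so that [P] has the character [z^-|Gamma|] on the
    stabiliser.  Hence, if a fraction [f / P^m] of even degree [k] is invariant,
    then the multiplicity of [f] at each point is congruent to [k/2] modulo
    [nu] ([counts_of_invariant]).  The converse holds when [f] is relatively
    invariant, because every rotation has a fixed point where its character can
    be computed ([invariant_of_counts]).

    The product of the forms [P_i ^ n(k)_i] has the least multiplicities
    subject to these congruences.  So it divides the numerator of every
    invariant of degree [k], and [P_k] is itself invariant: dividing by [P_k]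
    sends invariants of degree [k] to invariants of degree [0], without any
    denominator but powers of [P] ([invariant_part_even]).  The exponent of [P]
    in [P_k] is an integer by the Riemann-Hurwitz count
    [\sum_i d_i (nu_i - 1) = 2 (|Gamma| - 1)], which holds because each
    nontrivial rotation has two fixed points ([riemann_hurwitz],
    [residual_degree_dvd]).  In odd degree, [-1] acts by [-1]
    ([invariant_part_odd]).

    The arguments need elements of the binary group above given rotations,
    whence the surjectivity of [SU2_to_SO3] ([SU2_to_SO3_surj]). *)

Set Implicit Arguments.
Unset Strict Implicit.

(** * The Bloch sphere as the projective line *)

Lemma sum_ord2 (V : nmodType) (F : 'I_2 -> V) : \sum_i F i = F 0 + F 1.
Proof.
rewrite !big_ord_recl big_ord0 addr0; congr (_ + F _); exact: val_inj.
Qed.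

Definition third : 'I_3 := Ordinal (isT : (2 < 3)%N).

Lemma sum_ord3 (V : nmodType) (F : 'I_3 -> V) :
  \sum_i F i = F 0 + F 1 + F third.
Proof.
rewrite !big_ord_recl big_ord0 addr0 addrA.
by congr (_ + F _ + F _); apply: val_inj.
Qed.

Lemma ord2P (P : 'I_2 -> Prop) : P 0 -> P 1 -> forall i, P i.
Proof.
move=> P0 P1 [[|[|//]] lti].
- rewrite (_ : Ordinal _ = 0) //; exact: val_inj.
- rewrite (_ : Ordinal _ = 1) //; exact: val_inj.
Qed.

Lemma ord3P (P : 'I_3 -> Prop) : P 0 -> P 1 -> P third -> forall i, P i.
Proof.
move=> P0 P1 P2 [[|[|[|//]]] lti].
- rewrite (_ : Ordinal _ = 0) //; exact: val_inj.
- rewrite (_ : Ordinal _ = 1) //; exact: val_inj.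
- rewrite (_ : Ordinal _ = third) //; exact: val_inj.
Qed.

Section Geometry.
Variable R : realType.
Notation C := R[i].
Notation M := (@SU2_to_SO3 R).

Local Notation Re := (@complex.Re R).
Local Notation Im := (@complex.Im R).

Lemma ReD (x y : C) : Re (x + y) = Re x + Re y.
Proof. by case: x y => ? ? []. Qed.
Lemma ImD (x y : C) : Im (x + y) = Im x + Im y.
Proof. by case: x y => ? ? []. Qed.
Lemma ReN (x : C) : Re (- x) = - Re x. Proof. by case: x. Qed.
Lemma ImN (x : C) : Im (- x) = - Im x. Proof. by case: x. Qed.
Lemma ReM (x y : C) : Re (x * y) = Re x * Re y - Im x * Im y.
Proof. by case: x y => ? ? []. Qed.
Lemma ImM (x y : C) : Im (x * y) = Re x * Im y + Im x * Re y.
Proof. by case: x y => ? ? []. Qed.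
Lemma ReJ (x : C) : Re (x^*) = Re x. Proof. by case: x. Qed.
Lemma ImJ (x : C) : Im (x^*) = - Im x. Proof. by case: x. Qed.
Lemma Re0 : Re 0 = 0. Proof. by []. Qed.
Lemma Im0 : Im 0 = 0. Proof. by []. Qed.
Lemma Re1 : Re 1 = 1. Proof. by []. Qed.
Lemma Im1 : Im 1 = 0. Proof. by []. Qed.
Lemma Rei : Re 'i%C = 0. Proof. by []. Qed.
Lemma Imi : Im 'i%C = 1. Proof. by []. Qed.
Lemma ReR (x : R) : Re (real_complex R x) = x. Proof. by []. Qed.
Lemma ImR (x : R) : Im (real_complex R x) = 0. Proof. by []. Qed.

Lemma ReC (a b : R) : Re (Complex a b) = a. Proof. by []. Qed.
Lemma ImC (a b : R) : Im (Complex a b) = b. Proof. by []. Qed.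

Definition ReImE := (ReC, ImC, ReD, ImD, ReN, ImN, ReM, ImM, ReJ, ImJ, Re0, Im0, Re1,
  Im1, Rei, Imi, ReR, ImR).

Lemma complex_eq (x y : C) : Re x = Re y -> Im x = Im y -> x = y.
Proof. by case: x y => ? ? [? ?] /= -> ->. Qed.

Lemma ReV_real (x : C) (r : R) : Re (x / real_complex R r) = Re x / r.
Proof. by rewrite -fmorphV ReM ReR ImR mulr0 subr0. Qed.

Definition normsq (v : 'cV[C]_2) : R :=
  Re (v 0 0) ^+ 2 + Im (v 0 0) ^+ 2 + Re (v 1 0) ^+ 2 + Im (v 1 0) ^+ 2.

Lemma normsq_gt0 v : v != 0 -> 0 < normsq v.
Proof.
apply: contra_neqT; rewrite -leNgt => n0.
have sq (x : R) : 0 <= x ^+ 2 by exact: sqr_ge0.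
have h a b c d : 0 <= a ^+ 2 -> 0 <= b ^+ 2 -> 0 <= c ^+ 2 -> 0 <= d ^+ 2 ->
   a ^+ 2 + b ^+ 2 + c ^+ 2 + d ^+ 2 <= 0 -> (a = 0) /\ (b = 0) /\ (c = 0) /\ (d = 0 :> R).
  by move=> A B CC D E; do ?split; apply/eqP; rewrite -sqrf_eq0; apply/eqP; lra.
have [a0 [b0 [c0 d0]]] := h _ _ _ _ (sq _) (sq _) (sq _) (sq _) n0.
by apply/colP; apply: ord2P; rewrite !mxE; apply: complex_eq.
Qed.

(** The Hopf map in real coordinates; all later facts on [bloch] are
    polynomial identities between these expressions. *)
Lemma bloch_coord (v : 'cV[C]_2) :
  let a := Re (v 0 0) in let b := Im (v 0 0) in
  let c := Re (v 1 0) in let d := Im (v 1 0) in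
  [/\ bloch v 0 0 = 2 * (a * c + b * d) / normsq v,
      bloch v 1 0 = 2 * (a * d - b * c) / normsq v &
      bloch v third 0 = (a ^+ 2 + b ^+ 2 - c ^+ 2 - d ^+ 2) / normsq v].
Proof.
move=> a b c d.
have nE : (v^t* *m v) 0 0 = real_complex R (normsq v).
  by apply: complex_eq; rewrite mxE sum_ord2 !mxE !ReImE /normsq; ring.
split; rewrite mxE nE ReV_real; congr (_ / _);
  rewrite mxE sum_ord2 !mxE !sum_ord2 !mxE /= !ReImE /a /b /c /d; ring.
Qed.

Definition det2 (v w : 'cV[C]_2) : C := v 0 0 * w 1 0 - v 1 0 * w 0 0.

Lemma cV3_eq (x y : 'cV[R]_3) :
  x 0 0 = y 0 0 -> x 1 0 = y 1 0 -> x third 0 = y third 0 -> x = y.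
Proof. by move=> e0 e1 e2; apply/colP; apply: ord3P. Qed.

Lemma on_sphereE (x : 'cV[R]_3) :
  on_sphere x = (x 0 0 ^+ 2 + x 1 0 ^+ 2 + x third 0 ^+ 2 == 1).
Proof.
rewrite /on_sphere; have -> : (x^T *m x == 1%:M) = ((x^T *m x) 0 0 == 1).
  apply/eqP/eqP => [->|e]; first by rewrite mxE.
  by apply/matrixP => i j; rewrite !ord1 e mxE.
by rewrite mxE sum_ord3 !mxE !expr2.
Qed.

Lemma bloch_on_sphere (v : 'cV[C]_2) : v != 0 -> on_sphere (bloch v).
Proof.
move=> /normsq_gt0/lt0r_neq0; rewrite on_sphereE.
case: (bloch_coord v) => -> -> ->; rewrite /normsq => n0.
by apply/eqP; field.
Qed.

(** This identity makes [det2 v w] vanish exactly when the scalar product of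
    the two unit vectors is [1], so that [bloch] separates the lines of C^2.
    *)
Lemma det2_bloch v w : v != 0 -> w != 0 ->
  2 * (Re (det2 v w) ^+ 2 + Im (det2 v w) ^+ 2) =
  normsq v * normsq w * (1 - (bloch v 0 0 * bloch w 0 0
     + bloch v 1 0 * bloch w 1 0 + bloch v third 0 * bloch w third 0)).
Proof.
move=> /normsq_gt0/lt0r_neq0 + /normsq_gt0/lt0r_neq0.
case: (bloch_coord v) => -> -> ->; case: (bloch_coord w) => -> -> ->.
rewrite /normsq /det2 !ReImE => n0 m0; field; exact/andP.
Qed.

Lemma bloch_eq v w : v != 0 -> w != 0 -> (bloch v == bloch w) = (det2 v w == 0).
Proof.
move=> v0 w0; have := det2_bloch v0 w0.
have := bloch_on_sphere v0; have := bloch_on_sphere w0; rewrite !on_sphereE.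
set p := bloch v; set q := bloch w => /eqP sq /eqP sp E.
have N0 : normsq v * normsq w != 0 by rewrite mulf_neq0 // lt0r_neq0 // normsq_gt0.
apply/eqP/eqP => [pq|d0].
  have : Re (det2 v w) ^+ 2 + Im (det2 v w) ^+ 2 = 0.
    by move: E; rewrite pq -!expr2 sq subrr mulr0 => /eqP; rewrite mulf_eq0 (pnatr_eq0 R 2) => /eqP.
  have := sqr_ge0 (Re (det2 v w)); have := sqr_ge0 (Im (det2 v w)) => h1 h2 h3.
  by apply: complex_eq; apply/eqP; rewrite -sqrf_eq0; apply/eqP; lra.
move: E; rewrite d0 !ReImE expr0n addr0 mulr0 => /esym/eqP.
rewrite mulf_eq0 (negPf N0) orFb subr_eq0 => /eqP E.
have := sqr_ge0 (p 0 0 - q 0 0); have := sqr_ge0 (p 1 0 - q 1 0).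
have := sqr_ge0 (p third 0 - q third 0) => h1 h2 h3.
have h : (p 0 0 - q 0 0) ^+ 2 + (p 1 0 - q 1 0) ^+ 2 + (p third 0 - q third 0) ^+ 2 = 0.
  by rewrite !sqrrB !mulr2n; lra.
by apply: cV3_eq; apply/eqP; rewrite -subr_eq0 -sqrf_eq0; apply/eqP; lra.
Qed.

Definition cvec2 (x y : C) : 'cV[C]_2 := \col_i nth 0 [:: x; y] i.

Lemma cvec2_0 x y : cvec2 x y 0 0 = x. Proof. by rewrite mxE. Qed.
Lemma cvec2_1 x y : cvec2 x y 1 0 = y. Proof. by rewrite mxE. Qed.

(** A vector on the line of a point of the sphere, by stereographic
    projection; the south pole, where the projection is undefined, is treated
    apart. *)
Definition line (p : 'cV[R]_3) : 'cV[C]_2 :=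
  if p third 0 == -1 then cvec2 0 1
  else cvec2 (Complex (1 + p third 0) 0) (Complex (p 0 0) (p 1 0)).

Lemma line_neq0 p : line p != 0.
Proof.
rewrite /line; case: (p third 0 =P -1) => [_|/eqP p1]; apply/eqP => /colP E.
  by have /eqP := E 1; rewrite cvec2_1 mxE oner_eq0.
by move: (congr1 Re (E 0)) => /eqP; rewrite cvec2_0 mxE /= addrC addr_eq0 (negPf p1).
Qed.

Lemma bloch_line p : on_sphere p -> bloch (line p) = p.
Proof.
rewrite on_sphereE => /eqP sp; have := line_neq0 p => /normsq_gt0/lt0r_neq0.
case: (bloch_coord (line p)); rewrite /normsq /line.
case: (p third 0 =P -1) => [p1|/eqP p1]; rewrite ?cvec2_0 ?cvec2_1 !ReImE => E0 E1 E2 n0.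
  rewrite p1 sqrrN expr1n in sp.
  have := sqr_ge0 (p 0 0); have := sqr_ge0 (p 1 0) => h1 h2.
  have e0 : p 0 0 = 0 by apply/eqP; rewrite -sqrf_eq0; apply/eqP; lra.
  have e1 : p 1 0 = 0 by apply/eqP; rewrite -sqrf_eq0; apply/eqP; lra.
  by apply: cV3_eq; rewrite ?E0 ?E1 ?E2 ?e0 ?e1 ?p1; field.
have p2 : 1 + p third 0 != 0 by rewrite addrC addr_eq0.
have sp' : p 0 0 ^+ 2 + p 1 0 ^+ 2 = (1 - p third 0) * (1 + p third 0) by lra.
have nE : (1 + p third 0) ^+ 2 + 0 ^+ 2 + p 0 0 ^+ 2 + p 1 0 ^+ 2 = 2 * (1 + p third 0).
  by rewrite expr0n /= addr0 -addrA sp'; ring.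
rewrite nE in E0 E1 E2; apply: cV3_eq; rewrite ?E0 ?E1 ?E2; try by field.
by rewrite expr0n /= addr0 -addrA -opprD sp'; field.
Qed.

Lemma det2_eq0P v w : v != 0 -> det2 v w = 0 -> exists c, w = c *: v.
Proof.
move=> v0 /eqP; rewrite /det2 subr_eq0 => /eqP E.
have [v00|v00] := eqVneq (v 0 0) 0; last first.
  exists (w 0 0 / v 0 0); apply/colP; apply: ord2P; rewrite mxE ?divfK //.
  by rewrite mulrAC [w 0 0 * _]mulrC -E mulrAC mulfV ?mul1r.
have v10 : v 1 0 != 0.
  by apply: contraNneq v0 => v10; apply/eqP/colP; apply: ord2P; rewrite mxE.
exists (w 1 0 / v 1 0); apply/colP; apply: ord2P; rewrite mxE ?divfK //.
rewrite v00 mulr0; apply/eqP; rewrite -(mulrI_eq0 _ (mulfI v10)).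
by rewrite -E v00 mul0r.
Qed.

End Geometry.

(** * Rotations of the sphere and SU(2) *)

Section Rotations.
Variable R : realType.
Notation C := R[i].
Notation M := (@SU2_to_SO3 R).

Lemma mul_mx2E m n (A : 'M[C]_(m, 2)) (B : 'M[C]_(2, n)) i j :
  (A *m B) i j = A i 0 * B 0 j + A i 1 * B 1 j.
Proof. by rewrite mxE sum_ord2. Qed.

Lemma det_mx2E (K : comPzRingType) (A : 'M[K]_2) :
  \det A = A 0 0 * A 1 1 - A 0 1 * A 1 0.
Proof.
have e1 : lift 0 0 = 1 :> 'I_2 by apply: val_inj.
have f0 : lift 1 0 = 0 :> 'I_2 by apply: val_inj.
rewrite (expand_det_row _ 0) sum_ord2 /cofactor !det_mx11 !mxE e1 f0 /=; ring.
Qed.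

Lemma SU2_unit (g : 'M[C]_2) : g \is SU2 R -> g \in unitmx.
Proof. by case/andP=> _ /eqP dg; rewrite unitmxE dg unitr1. Qed.

Lemma SU2_adj (g : 'M[C]_2) : g \is SU2 R -> invmx g = g^t*.
Proof.
move=> gS; have gU := SU2_unit gS; case/andP: gS => /unitarymxP gg _.
by rewrite -[LHS]mulmx1 -gg mulmxA mulVmx // mul1mx.
Qed.

Lemma SU2_1 : (1%:M : 'M[C]_2) \is SU2 R.
Proof.
apply/andP; split; last by rewrite det1.
by apply/unitarymxP; rewrite mul1mx trmx1 map_mx1.
Qed.

Lemma SU2M (g h : 'M[C]_2) : g \is SU2 R -> h \is SU2 R -> g *m h \is SU2 R.
Proof.
case/andP=> /unitarymxP gg /eqP dg /andP[/unitarymxP hh /eqP dh].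
apply/andP; split; last by rewrite det_mulmx dg dh mulr1.
apply/unitarymxP; rewrite trmx_mul map_mxM -mulmxA (mulmxA h) hh mul1mx //.
Qed.

Lemma SU2V (g : 'M[C]_2) : g \is SU2 R -> invmx g \is SU2 R.
Proof.
move=> gS; have gU := SU2_unit gS; apply/andP; split.
  apply/unitarymxP; rewrite (SU2_adj gS) trmxCK -(SU2_adj gS) mulVmx //.
by case/andP: gS => _ /eqP dg; rewrite det_inv dg invr1.
Qed.

Lemma SU2N (g : 'M[C]_2) : g \is SU2 R -> - g \is SU2 R.
Proof.
case/andP=> /unitarymxP gg /eqP dg; apply/andP; split.
  by apply/unitarymxP; rewrite linearN /= map_mxN mulNmx mulmxN opprK.
by rewrite -scaleN1r detZ dg mulr1 sqrrN expr1n.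
Qed.

Definition su2 (a b c d : R) : 'M[C]_2 :=
  mx2 (Complex a b) (Complex (- c) d) (Complex c d) (Complex a (- b)).

Lemma su2_SU2 a b c d : a ^+ 2 + b ^+ 2 + c ^+ 2 + d ^+ 2 = 1 ->
  su2 a b c d \is SU2 R.
Proof.
move=> n1; apply/andP; split.
  apply/unitarymxP/matrixP; apply: ord2P; apply: ord2P;
  by rewrite mul_mx2E !mxE; apply: complex_eq; rewrite !ReImE; lra.
by rewrite det_mx2E !mxE; apply/eqP/complex_eq; rewrite !ReImE; lra.
Qed.

(** Since the determinant is 1 and the inverse is the conjugate transpose, the
    second column is determined by the first. *)
Lemma SU2_su2 (g : 'M[C]_2) : g \is SU2 R -> exists a b c d,
  a ^+ 2 + b ^+ 2 + c ^+ 2 + d ^+ 2 = 1 /\ g = su2 a b c d.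
Proof.
case/andP=> /unitarymxP/matrixP gg; rewrite det_mx2E => /eqP.
have := gg 0 0; have := gg 0 1; rewrite !mul_mx2E !mxE /= mulr0n mulr1n.
have -> : g = mx2 (g 0 0) (g 0 1) (g 1 0) (g 1 1).
  by apply/matrixP; apply: ord2P; apply: ord2P; rewrite !mxE.
rewrite !mxE /=.
move: (g 0 0) (g 0 1) (g 1 0) (g 1 1) => x y z t e1 e0 dt.
have e1' : x^* * z + y^* * t = 0.
  apply: complex_eq; move: (congr1 (@complex.Re R) e1) (congr1 (@complex.Im R) e1);
  by rewrite !ReImE => h1 h2; lra.
have tE : t = x^*.
  rewrite -[RHS]mulr1 -dt.
  transitivity ((x * x^* + y * y^*) * t - y * (x^* * z + y^* * t)); last by ring.
  by rewrite e0 e1'; ring.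
have yE : z = - y^*.
  rewrite -[RHS]mulr1 -dt.
  transitivity ((x * x^* + y * y^*) * z - x * (x^* * z + y^* * t)); last by ring.
  by rewrite e0 e1'; ring.
case: x {dt e1 e1'} e0 tE yE => a b; case: y => c d e0 -> ->.
exists a, b, (- c), d; split.
  by have := congr1 (@complex.Re R) e0; rewrite !ReImE => <-; ring.
apply/matrixP; apply: ord2P; apply: ord2P; rewrite !mxE /=;
  apply: complex_eq => /=; rewrite ?opprK //.
Qed.

Definition mx3 (r : seq (seq R)) : 'M[R]_3 :=
  \matrix_(i, j) nth 0 (nth [::] r i) j.

(** The Euler-Rodrigues formula; orthogonality and the value of the
    determinant follow from it by polynomial identities. *)
Lemma SU2_to_SO3_su2 a b c d : M (su2 a b c d) = mx3
  [:: [:: a ^+ 2 - b ^+ 2 - c ^+ 2 + d ^+ 2; 2 * (a * b - c * d); 2 * (a * c + b * d)];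
      [:: - 2 * (a * b + c * d); a ^+ 2 - b ^+ 2 + c ^+ 2 - d ^+ 2; 2 * (a * d - b * c)];
      [:: 2 * (b * d - a * c); - 2 * (a * d + b * c); a ^+ 2 + b ^+ 2 - c ^+ 2 - d ^+ 2]].
Proof.
have r2 : (2 : C) = real_complex R 2 by rewrite rmorph_nat.
apply/matrixP; apply: ord3P; apply: ord3P; rewrite mxE r2 ReV_real;
  apply: (canLR (mulfK _)); rewrite ?pnatr_eq0 //;
  rewrite /mxtrace sum_ord2 !mul_mx2E !mxE /= ?ReImE /=; ring.
Qed.

Lemma SO3P (A : 'M[R]_3) : reflect (A^T *m A = 1%:M /\ \det A = 1) (A \is SO3 R).
Proof.
apply: (iffP andP) => [[/eqP AA /eqP dA]|[AA dA]].
  by split=> //; apply: mulmx1C.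
by rewrite dA eqxx; split=> //; apply/eqP; apply: mulmx1C.
Qed.

Lemma det_mx3E (A : 'M[R]_3) : \det A =
  A 0 0 * (A 1 1 * A third third - A 1 third * A third 1)
  - A 0 1 * (A 1 0 * A third third - A 1 third * A third 0)
  + A 0 third * (A 1 0 * A third 1 - A 1 1 * A third 0).
Proof.
have e1 : lift 0 0 = 1 :> 'I_3 by apply: val_inj.
have e2 : lift 0 1 = third :> 'I_3 by apply: val_inj.
have f0 : lift 1 0 = 0 :> 'I_3 by apply: val_inj.
have f1 : lift 1 1 = third :> 'I_3 by apply: val_inj.
have g0 : lift third 0 = 0 :> 'I_3 by apply: val_inj.
have g1 : lift third 1 = 1 :> 'I_3 by apply: val_inj.
rewrite (expand_det_row _ 0) sum_ord3 /cofactor !det_mx2E !mxE.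
rewrite ?e1 ?e2 ?f0 ?f1 ?g0 ?g1 /=; ring.
Qed.

Lemma SU2_to_SO3_SO3 g : g \is SU2 R -> M g \is SO3 R.
Proof.
case/SU2_su2=> a [b [c [d [n1 ->]]]]; rewrite SU2_to_SO3_su2; apply/SO3P.
have n2 : (a ^+ 2 + b ^+ 2 + c ^+ 2 + d ^+ 2) ^+ 2 = 1 by rewrite n1 expr1n.
have n3 : (a ^+ 2 + b ^+ 2 + c ^+ 2 + d ^+ 2) ^+ 3 = 1 by rewrite n1 expr1n.
split; last by rewrite det_mx3E !mxE /= -[RHS]n3; ring.
by apply/matrixP; apply: ord3P; apply: ord3P; rewrite mxE sum_ord3 !mxE /=;
  first [ring | rewrite -[RHS]n2; ring].
Qed.

Lemma SO3_on_sphere (A : 'M[R]_3) x : A \is SO3 R -> on_sphere x -> on_sphere (A *m x).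
Proof.
by case/SO3P=> AA _; rewrite /on_sphere trmx_mul -mulmxA (mulmxA A^T) AA mul1mx.
Qed.

Lemma SO3M (A B : 'M[R]_3) : A \is SO3 R -> B \is SO3 R -> A *m B \is SO3 R.
Proof.
case/SO3P=> AA dA /SO3P[BB dB]; apply/SO3P.
by rewrite det_mulmx dA dB mulr1 trmx_mul -mulmxA (mulmxA A^T) AA mul1mx.
Qed.

Lemma SO3T (A : 'M[R]_3) : A \is SO3 R -> A^T \is SO3 R.
Proof. by case/andP=> AA dA; apply/SO3P; rewrite trmxK det_tr (eqP AA) (eqP dA). Qed.

Lemma sphere_mx_ext (A B : 'M[R]_3) :
  (forall x, on_sphere x -> A *m x = B *m x) -> A = B.
Proof.
move=> AB; apply/matrixP => i j.
have : on_sphere (delta_mx j 0 : 'cV[R]_3).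
  by rewrite on_sphereE !mxE; move: j; apply: ord3P => /=; rewrite !expr2; apply/eqP; ring.
by move/AB; rewrite -!colE => /colP/(_ i); rewrite !mxE.
Qed.

(** Multiplicativity comes from [bloch_act]: both sides act in the same way on
    the sphere, which spans the space. *)
Lemma SU2_to_SO3M g h : g \is SU2 R -> h \is SU2 R -> M (g *m h) = M g *m M h.
Proof.
move=> gS hS; apply: sphere_mx_ext => x xS; rewrite -{1}(bloch_line xS).
by rewrite -bloch_act ?SU2M // -!mulmxA bloch_act // bloch_act // bloch_line.
Qed.

Lemma SU2_to_SO3_1 : M 1%:M = 1%:M.
Proof.
apply: sphere_mx_ext => x xS; rewrite -(bloch_line xS).
by rewrite -bloch_act ?SU2_1 // !mul1mx.
Qed.

Lemma blochZ (c : C) v : c != 0 -> v != 0 -> bloch (c *: v) = bloch v.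
Proof.
move=> c0 v0; apply/eqP; rewrite bloch_eq ?scaler_eq0 ?negb_or ?c0 //.
by rewrite /det2 !mxE; apply/eqP; ring.
Qed.

Lemma SU2_to_SO3_N1 : M (- 1%:M) = 1%:M.
Proof.
apply: sphere_mx_ext => x xS; rewrite -(bloch_line xS) -bloch_act ?SU2N ?SU2_1 //.
by rewrite mulNmx !mul1mx -scaleN1r blochZ ?line_neq0 // oppr_eq0 oner_eq0.
Qed.

Lemma SU2_to_SO3V g : g \is SU2 R -> M (invmx g) = (M g)^T.
Proof.
move=> gS; have /SO3P[MM _] := SU2_to_SO3_SO3 gS.
rewrite -[LHS]mul1mx -MM -mulmxA -SU2_to_SO3M ?SU2V //.
by rewrite mulmxV ?SU2_unit // SU2_to_SO3_1 mulmx1.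
Qed.

Definition north : 'cV[R]_3 := \col_i nth 0 [:: 0; 0; 1] i.

Lemma bloch_north : bloch (cvec2 1 0 : 'cV[C]_2) = north.
Proof.
have := bloch_coord (cvec2 1 0 : 'cV[C]_2).
rewrite /normsq cvec2_0 cvec2_1 !ReImE => -[E0 E1 E2].
by apply: cV3_eq; rewrite ?E0 ?E1 ?E2 mxE /=; field.
Qed.

(** The unitary matrix whose first column is the normalised vector of [line
    p]; its rotation carries the north pole to [p]. *)
Definition lift_pole (p : 'cV[R]_3) : 'M[C]_2 :=
  let v := line p in let r := Num.sqrt (normsq v) in
  su2 (complex.Re (v 0 0) / r) (complex.Im (v 0 0) / r)
      (complex.Re (v 1 0) / r) (complex.Im (v 1 0) / r).

Lemma lift_pole_SU2 p : lift_pole p \is SU2 R.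
Proof.
have n0 := normsq_gt0 (line_neq0 p).
apply: su2_SU2; rewrite !expr_div_n sqr_sqrtr ?ltW // -!mulrDl.
by rewrite divff ?lt0r_neq0.
Qed.

Lemma lift_pole_col p : exists2 c, c != 0 & lift_pole p *m cvec2 1 0 = c *: line p.
Proof.
have n0 : Num.sqrt (normsq (line p)) != 0.
  by rewrite lt0r_neq0 // sqrtr_gt0 normsq_gt0 // line_neq0.
exists (real_complex R (Num.sqrt (normsq (line p)))^-1).
  by rewrite fmorph_eq0 invr_eq0.
apply/colP; apply: ord2P; rewrite mul_mx2E cvec2_0 cvec2_1 mulr1 mulr0 addr0 !mxE /=;
  apply: complex_eq; rewrite !ReImE; ring.
Qed.

Lemma lift_pole_north p : on_sphere p -> M (lift_pole p) *m north = p.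
Proof.
move=> ps; rewrite -bloch_north -bloch_act ?lift_pole_SU2 //.
by have [c c0 ->] := lift_pole_col p; rewrite blochZ ?line_neq0 // bloch_line.
Qed.

Definition rotz (c s : R) : 'M[R]_3 :=
  mx3 [:: [:: c; - s; 0]; [:: s; c; 0]; [:: 0; 0; 1]].

(** The third row equals the third column by orthogonality, and the
    determinant selects rotations among the plane isometries that remain. *)
Lemma SO3_north (B : 'M[R]_3) : B \is SO3 R -> B *m north = north ->
  B = rotz (B 0 0) (B 1 0) /\ B 0 0 ^+ 2 + B 1 0 ^+ 2 = 1.
Proof.
move=> /SO3P[BB dB] Bn.
have Bn' : B^T *m north = north by rewrite -{1}Bn mulmxA BB mul1mx.
have E (A : 'M[R]_3) i : (A *m north) i 0 = A i third.
  by rewrite mxE sum_ord3 !mxE /= mulr1 !mulr0 !add0r.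
have e02 : B 0 third = 0 by rewrite -E Bn mxE.
have e12 : B 1 third = 0 by rewrite -E Bn mxE.
have e22 : B third third = 1 by rewrite -E Bn mxE.
have e20 : B third 0 = 0 by have := E B^T 0; rewrite Bn' !mxE.
have e21 : B third 1 = 0 by have := E B^T 1; rewrite Bn' !mxE.
have /matrixP BE := BB.
have := BE 0 0; have := BE 0 1; rewrite !mxE !sum_ord3 !mxE /= e20 e21.
move: dB; rewrite det_mx3E e22 e12 e02 e20 e21.
set c := B 0 0; set s := B 1 0; set t := B 0 1; set u := B 1 1 => d1 e1 e0.
have cs : c ^+ 2 + s ^+ 2 = 1 by lra.
(* [u] and [t] solve the linear system given by the determinant and by
   the orthogonality of the first two columns *)
have uE : u = c.
  rewrite -[LHS]mul1r -cs; transitivity (c * (c * u - t * s) + s * (c * t + s * u)); first by ring.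
  have -> : c * u - t * s = 1 by lra.
  have -> : c * t + s * u = 0 by lra.
  by ring.
have tE : t = - s.
  rewrite -[LHS]mul1r -cs; transitivity (- s * (c * u - t * s) + c * (c * t + s * u)); first by ring.
  have -> : c * u - t * s = 1 by lra.
  have -> : c * t + s * u = 0 by lra.
  by ring.
split=> //; apply/matrixP; apply: ord3P; apply: ord3P; rewrite [RHS]mxE //=.
Qed.

Lemma SU2_to_SO3_diag a b : a ^+ 2 + b ^+ 2 = 1 ->
  M (su2 a b 0 0) = rotz (a ^+ 2 - b ^+ 2) (- 2 * (a * b)).
Proof.
move=> n1; rewrite SU2_to_SO3_su2; apply/matrixP.
apply: ord3P; apply: ord3P; rewrite !mxE /=;
  by [ring | rewrite -[RHS]n1; ring].
Qed.

End Rotations.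

Section Surjectivity.
Variable R : realType.
Notation C := R[i].
Notation M := (@SU2_to_SO3 R).
Notation north := (north R).

Lemma SO3_tr_mul (A : 'M[R]_3) : A \is SO3 R -> A^T *m A = 1%:M.
Proof. by case/SO3P. Qed.

Lemma SO3_mul_tr (A : 'M[R]_3) : A \is SO3 R -> A *m A^T = 1%:M.
Proof. by move/SO3_tr_mul/mulmx1C. Qed.

Lemma north_on_sphere : on_sphere north.
Proof. by rewrite on_sphereE !mxE /=; apply/eqP; ring. Qed.

(** A square root of a unit complex number; diagonal matrices of SU(2) rotate
    by twice their argument. *)
Lemma rotz_half_angle (c s : R) : c ^+ 2 + s ^+ 2 = 1 ->
  exists a b, [/\ a ^+ 2 + b ^+ 2 = 1, a ^+ 2 - b ^+ 2 = c & - 2 * (a * b) = s].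
Proof.
move=> cs; have := sqr_sqrtc (Complex c (- s)); case: (sqrtc _) => a b.
rewrite expr2 => E; exists a, b.
have := congr1 (@complex.Re R) E; have := congr1 (@complex.Im R) E.
rewrite !ReImE => E1 E0; split; [|lra|lra].
have : (a ^+ 2 + b ^+ 2) ^+ 2 = 1 ^+ 2.
  rewrite expr1n -cs.
  have -> : c = a * a - b * b by lra.
  have -> : s = - (a * b + b * a) by lra.
  by ring.
move/eqP; rewrite eqrXn2 ?ler01 ?addr_ge0 ?sqr_ge0 // => /eqP //.
Qed.

Lemma lift_pole_tr p : on_sphere p -> (M (lift_pole p))^T *m p = north.
Proof.
move=> ps; rewrite -[X in _ *m X](lift_pole_north ps) mulmxA SO3_tr_mul ?mul1mx //.
exact: SU2_to_SO3_SO3 (lift_pole_SU2 p).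
Qed.

(** A rotation carrying the north pole to [p] differs from the one of
    [lift_pole p] by a rotation about the axis, which lifts to a diagonal
    matrix. *)
Theorem SU2_to_SO3_surj (A : 'M[R]_3) : A \is SO3 R ->
  exists2 g, g \is SU2 R & M g = A.
Proof.
move=> AS; set p := A *m north; set k := lift_pole p.
have ps : on_sphere p by rewrite SO3_on_sphere ?north_on_sphere.
have kS : k \is SU2 R := lift_pole_SU2 p.
have kS3 := SU2_to_SO3_SO3 kS.
set B := (M k)^T *m A.
have BS : B \is SO3 R by rewrite SO3M ?SO3T.
have Bn : B *m north = north.
  by rewrite -mulmxA lift_pole_tr.
have [BE /rotz_half_angle[a [b [n1 cE sE]]]] := SO3_north BS Bn.
exists (k *m su2 a b 0 0).
  by rewrite SU2M // su2_SU2 // expr0n /= !addr0.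
rewrite SU2_to_SO3M // ?su2_SU2 // ?expr0n /= ?addr0 //.
rewrite SU2_to_SO3_diag // cE sE -BE /B mulmxA SO3_mul_tr // mul1mx //.
Qed.

(** The conjugate of [A] that turns a rotation about [p] into one about the
    north pole. *)
Definition rot_at (p : 'cV[R]_3) (A : 'M[R]_3) : 'M[R]_3 :=
  (M (lift_pole p))^T *m A *m M (lift_pole p).

(** The angle of [A] about [p], as a unit complex number.  The sign is the one
    for which [angle_eigen] holds without conjugation. *)
Definition angle (p : 'cV[R]_3) (A : 'M[R]_3) : C :=
  Complex (rot_at p A 0 0) (- rot_at p A 1 0).

Lemma lift_pole_SO3 p : M (lift_pole p) \is SO3 R.
Proof. exact: SU2_to_SO3_SO3 (lift_pole_SU2 p). Qed.

Lemma rot_at_SO3 p A : A \is SO3 R -> rot_at p A \is SO3 R.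
Proof. by move=> AS; rewrite !SO3M ?SO3T ?lift_pole_SO3. Qed.

Lemma rot_at_north p A (q : 'cV[R]_3) : rot_at p A *m ((M (lift_pole p))^T *m q) =
  (M (lift_pole p))^T *m (A *m q).
Proof.
by rewrite /rot_at -!mulmxA (mulmxA (M _)) SO3_mul_tr ?lift_pole_SO3 // mul1mx.
Qed.

Lemma rot_at_fix p A : A \is SO3 R -> on_sphere p -> A *m p = p ->
  rot_at p A = rotz (rot_at p A 0 0) (rot_at p A 1 0) /\
  rot_at p A 0 0 ^+ 2 + rot_at p A 1 0 ^+ 2 = 1.
Proof.
move=> AS ps Ap; apply: SO3_north; first exact: rot_at_SO3.
by rewrite /rot_at -!mulmxA lift_pole_north // Ap lift_pole_tr.
Qed.

Lemma rot_atK p (A : 'M[R]_3) :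
  M (lift_pole p) *m rot_at p A *m (M (lift_pole p))^T = A.
Proof.
rewrite /rot_at !mulmxA SO3_mul_tr ?lift_pole_SO3 // mul1mx -mulmxA.
by rewrite SO3_mul_tr ?lift_pole_SO3 // mulmx1.
Qed.

Lemma angle_inj p A B : on_sphere p -> A \is SO3 R -> B \is SO3 R ->
  A *m p = p -> B *m p = p -> angle p A = angle p B -> A = B.
Proof.
move=> ps AS BS Ap Bp [e0 /oppr_inj e1].
have [AE _] := rot_at_fix AS ps Ap; have [BE _] := rot_at_fix BS ps Bp.
by rewrite -(rot_atK p A) -(rot_atK p B) AE BE e0 e1.
Qed.

Lemma rot_atM p A B : rot_at p (A *m B) = rot_at p A *m rot_at p B.
Proof.
rewrite /rot_at -!mulmxA; congr (_ *m (_ *m _)).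
by rewrite (mulmxA (M _)) SO3_mul_tr ?lift_pole_SO3 // mul1mx.
Qed.

Lemma angleM p A B : on_sphere p -> A \is SO3 R -> B \is SO3 R ->
  A *m p = p -> B *m p = p -> angle p (A *m B) = angle p A * angle p B.
Proof.
move=> ps AS BS Ap Bp.
have [AE _] := rot_at_fix AS ps Ap; have [BE _] := rot_at_fix BS ps Bp.
rewrite /angle rot_atM; move: (rot_at p A) (rot_at p B) AE BE => X Y.
move: (X 0 0) (X 1 0) (Y 0 0) (Y 1 0) => c s c' s' -> ->.
rewrite !mxE !sum_ord3 !mxE /=.
by apply: complex_eq; rewrite !ReImE; ring.
Qed.

Lemma angle_neq0 p A : on_sphere p -> A \is SO3 R -> A *m p = p -> angle p A != 0.
Proof.
move=> ps AS Ap; have [_ n1] := rot_at_fix AS ps Ap.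
apply/eqP => -[c0 s0]; move: n1; rewrite c0 (_ : rot_at p A 1 0 = 0) ?expr0n ?addr0 /=.
  by move/eqP; rewrite eq_sym oner_eq0.
by apply/eqP; rewrite -oppr_eq0 s0.
Qed.

Lemma eigen_of_fix g p : g \is SU2 R -> on_sphere p -> M g *m p = p ->
  exists2 z : C, z != 0 & g *m line p = z *: line p.
Proof.
move=> gS ps gp; have p0 := line_neq0 p; have gU := SU2_unit gS.
have gp0 : g *m line p != 0.
  by apply: contraNneq p0 => E; rewrite -(mulKmx gU (line p)) E mulmx0.
have /eqP : bloch (line p) = bloch (g *m line p) by rewrite bloch_act // bloch_line.
rewrite bloch_eq // => /eqP/(det2_eq0P p0)[z zE]; exists z => //.
by apply: contraNneq gp0 => z0; rewrite zE z0 scale0r.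
Qed.

(** After conjugation by [lift_pole p] the matrix is diagonal with first entry
    [z], and rotates by twice the argument of [z]. *)
Lemma angle_eigen g p z : g \is SU2 R -> on_sphere p ->
  g *m line p = z *: line p -> angle p (M g) = z ^+ 2.
Proof.
move=> gS ps gz; set k := lift_pole p; set e : 'cV[C]_2 := cvec2 1 0.
have kS : k \is SU2 R := lift_pole_SU2 p.
have [c c0 ke] := lift_pole_col p.
have dS : invmx k *m g *m k \is SU2 R by rewrite !SU2M ?SU2V.
have de : (invmx k *m g *m k) *m e = z *: e.
  rewrite -!mulmxA ke -scalemxAr gz scalerA mulrC -scalerA -ke -scalemxAr.
  by rewrite mulKmx // SU2_unit.
have rE : rot_at p (M g) = M (invmx k *m g *m k).
  by rewrite !SU2_to_SO3M ?SU2M ?SU2V // SU2_to_SO3V.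
rewrite /angle rE; case/SU2_su2: dS de => [a [b [c' [d [_ ->]]]]] /colP de.
have {}de i : su2 a b c' d i 0 = z * e i 0.
  by have := de i; rewrite mul_mx2E cvec2_0 cvec2_1 mulr1 mulr0 addr0 [RHS]mxE.
move: (de 0) (de 1); rewrite cvec2_0 cvec2_1 mulr1 mulr0 ![su2 _ _ _ _ _ _]mxE /=.
move=> <- [-> ->]; rewrite SU2_to_SO3_su2 !mxE /= expr2.
by apply: complex_eq; rewrite !ReImE; ring.
Qed.

(** In odd dimension [det (A - 1) = - det (A - 1)], since [A - 1 = - A (A -
    1)^T]. *)
Lemma SO3_has_fixpoint (A : 'M[R]_3) : A \is SO3 R ->
  exists2 q, on_sphere q & A *m q = q.
Proof.
move=> AS; have /SO3P[AA dA] := AS.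
have : \det (A^T - 1%:M) == 0.
  have E : A^T - 1%:M = - (A^T *m (A^T - 1%:M)^T).
    by rewrite linearB /= trmxK trmx1 mulmxBr AA mulmx1 opprB.
  have : \det (A^T - 1%:M) = - \det (A^T - 1%:M).
    rewrite {1}E -scaleN1r detZ det_mulmx !det_tr dA mul1r.
    by rewrite exprS sqrrN expr1n mulr1 mulN1r.
  move/eqP; rewrite -addr_eq0 -mulr2n mulrn_eq0 //.
move/det0P => [v v0]; rewrite mulmxBr mulmx1 => /eqP; rewrite subr_eq0 => /eqP Av.
set x := v^T; have x0 : x != 0 by rewrite trmx_eq0.
set N := x 0 0 ^+ 2 + x 1 0 ^+ 2 + x third 0 ^+ 2.
have N0 : 0 < N.
  rewrite lt_def !addr_ge0 ?sqr_ge0 // andbT; apply: contraNneq x0.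
  have := sqr_ge0 (x 0 0); have := sqr_ge0 (x 1 0); have := sqr_ge0 (x third 0).
  move=> h1 h2 h3 h4; apply/eqP; rewrite /N in h4.
  by apply: cV3_eq; rewrite [RHS]mxE; apply/eqP; rewrite -sqrf_eq0; apply/eqP; lra.
exists ((Num.sqrt N)^-1 *: x).
  have sE i : ((Num.sqrt N)^-1 *: x) i 0 = (Num.sqrt N)^-1 * x i 0 by rewrite mxE.
  rewrite on_sphereE !sE !exprMn -!mulrDr -/N exprVn sqr_sqrtr ?ltW //.
  by rewrite mulVf ?eqxx // lt0r_neq0.
by rewrite -scalemxAr; congr (_ *: _); rewrite -[A]trmxK -trmx_mul Av.
Qed.

(** In the coordinates of [rot_at] a fixed point has its horizontal part fixed
    by a plane rotation, so the horizontal part is zero unless the rotation is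
    trivial. *)
Lemma SO3_two_fixpoints (A : 'M[R]_3) : A \is SO3 R -> A != 1%:M ->
  exists q, [/\ on_sphere q, on_sphere (- q), q != - q &
    forall p, on_sphere p -> (A *m p == p) = (p == q) || (p == - q)].
Proof.
move=> AS A1; have [q qs Aq] := SO3_has_fixpoint AS; exists q.
split=> //.
- by move: qs; rewrite !on_sphereE !mxE !sqrrN.
- apply/eqP => qq; move: qs; rewrite on_sphereE.
  have z i : q i 0 = 0.
    by have /colP/(_ i) := qq; rewrite mxE => h; lra.
  by rewrite !z expr0n /= !addr0 eq_sym oner_eq0.
move=> p ps; apply/eqP/orP => [Ap|[/eqP-> //|/eqP->]]; last by rewrite mulmxN Aq.
have [] := rot_at_fix AS qs Aq; set c := rot_at q A 0 0; set s := rot_at q A 1 0.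
move=> BE cs; set h := M (lift_pole q).
have hS : h \is SO3 R := lift_pole_SO3 q.
set y := h^T *m p.
have ys : on_sphere y by rewrite SO3_on_sphere ?SO3T.
have By : rot_at q A *m y = y by rewrite rot_at_north Ap.
have pE : p = h *m y by rewrite mulmxA SO3_mul_tr // mul1mx.
have qE : q = h *m north by rewrite lift_pole_north.
have c1 : c != 1.
  apply: contraNneq A1 => c1; have s0 : s = 0.
    by apply/eqP; rewrite -sqrf_eq0; apply/eqP; move: cs; rewrite c1 expr1n; lra.
  rewrite -(rot_atK q A) BE c1 s0 (_ : rotz 1 0 = 1%:M) ?mulmx1 ?SO3_mul_tr //.
  by apply/matrixP; apply: ord3P; apply: ord3P; rewrite !mxE //= oppr0.
move: By; rewrite BE; clear BE; clearbody c s y => /colP By.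
have := By 0; have := By 1.
rewrite !mxE !sum_ord3 !mxE /= => e1 e0.
have k0 : 2 * (1 - c) != 0 by rewrite mulf_neq0 ?pnatr_eq0 // subr_eq0 eq_sym.
have f0 : (1 - c) * y 0 0 + s * y 1 0 = 0 by lra.
have f1 : s * y 0 0 - (1 - c) * y 1 0 = 0 by lra.
(* the two equations [f0], [f1] form a linear system of determinant [- 2 (1 - c)] *)
have kE : 2 * (1 - c) = (1 - c) ^+ 2 + s ^+ 2 by lra.
have y0 : y 0 0 = 0.
  apply: (mulfI k0); rewrite mulr0 kE.
  transitivity ((1 - c) * ((1 - c) * y 0 0 + s * y 1 0)
    + s * (s * y 0 0 - (1 - c) * y 1 0)); first by ring.
  by rewrite f0 f1 !mulr0 addr0.
have y1 : y 1 0 = 0.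
  apply: (mulfI k0); rewrite mulr0 kE.
  transitivity (s * ((1 - c) * y 0 0 + s * y 1 0)
    - (1 - c) * (s * y 0 0 - (1 - c) * y 1 0)); first by ring.
  by rewrite f0 f1 !mulr0 subr0.
move: ys; rewrite on_sphereE y0 y1 expr0n /= !add0r -[1](expr1n _ 2) eqf_sqr.
case/orP=> /eqP y2; [left|right]; rewrite pE qE -?mulmxN; apply/eqP; congr (_ *m _);
  by apply: cV3_eq; rewrite ?y0 ?y1 ?y2 !mxE ?oppr0.
Qed.

End Surjectivity.

(** * Divisors of binary forms *)

Section BinaryForms.
Variable R : realType.
Notation C := R[i].
Notation M := (@SU2_to_SO3 R).
Notation form := {mpoly C[2]}.

Definition ev (f : form) (v : 'cV[C]_2) : C := f.@[fun i => v i 0].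

Lemma evM f h v : ev (f * h) v = ev f v * ev h v.
Proof. exact: mevalM. Qed.

Lemma evZ c f v : ev (c *: f) v = c * ev f v.
Proof. exact: mevalZ. Qed.

Lemma det2vv (v : 'cV[C]_2) : det2 v v = 0.
Proof. by rewrite /det2 mulrC subrr. Qed.

(** The form [u |-> det2 u v]; its zeros are the multiples of [v]. *)
Definition lform (v : 'cV[C]_2) : form := v 1 0 *: 'X_0 - v 0 0 *: 'X_1.

Lemma ev_lform v w : ev (lform v) w = - det2 v w.
Proof. by rewrite /ev mevalB !mevalZ !mevalXU /det2 opprB. Qed.

Lemma lform_homog v : lform v \is 1.-homog.
Proof.
have X1 i : 'X_i \is [in C[2], 1.-homog] by rewrite dhomogX; apply/eqP/mdeg1.
by rewrite rpredB ?rpredZ.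
Qed.

Lemma lformZ c v : lform (c *: v) = c *: lform v.
Proof. by rewrite /lform !mxE scalerBr !scalerA. Qed.

Lemma det2_vec (v : 'cV[C]_2) : v != 0 -> exists w, det2 v w != 0.
Proof.
move=> v0; have [v00|v00] := eqVneq (v 0 0) 0; last first.
  by exists (cvec2 0 1); rewrite /det2 cvec2_0 cvec2_1 mulr1 mulr0 subr0.
exists (cvec2 1 0); rewrite /det2 cvec2_0 cvec2_1 mulr1 mulr0 sub0r oppr_eq0.
by apply: contraNneq v0 => v10; apply/eqP/colP; apply: ord2P; rewrite mxE.
Qed.

Lemma lform_neq0 (v : 'cV[C]_2) : v != 0 -> lform v != 0.
Proof.
case/det2_vec=> w; apply: contraNneq => v0.
by rewrite -oppr_eq0 -ev_lform v0 /ev meval0.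
Qed.

Lemma SU2_inv2 (g : 'M[C]_2) : g \is SU2 R ->
  invmx g = mx2 (g 1 1) (- g 0 1) (- g 1 0) (g 0 0).
Proof.
move=> gS; have gU := SU2_unit gS; case/andP: gS => _ /eqP dg.
rewrite -[LHS]mulmx1; apply: (canLR (mulKmx gU)).
apply/matrixP; move: dg; rewrite det_mx2E => dg.
apply: ord2P; apply: ord2P; rewrite mul_mx2E !mxE /= ?mulr1n ?mulr0n -?dg; ring.
Qed.

(** Matrices of determinant 1 preserve [det2], so moving the argument by
    [g^-1] amounts to moving [v] by [g]. *)
Lemma act_lform g v : g \is SU2 R -> act g (lform v) = lform (g *m v).
Proof.
move=> gS; rewrite /act raddfB /= !linearZ /= -!/(act g _) !act_var.
rewrite SU2_inv2 // !sum_ord2 /lform !mul_mx2E !mxE /=.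
by rewrite -!mul_mpolyC !(mpolyCD, mpolyCN, mpolyCM); ring.
Qed.


Lemma ev_act g f v : ev (act g f) v = ev f (invmx g *m v).
Proof.
rewrite /ev /act comp_mpoly_meval; apply: meval_eq => i.
by rewrite tnth_mktuple raddf_sum mxE; apply: eq_bigr => j _; rewrite /= mevalZ mevalXU.
Qed.

(** For [q] of degree at most [d], the form of degree [d] that becomes [q] at
    [Y = 1]; it transfers factorisations from univariate polynomials to forms.
    *)
Definition homogenize d (q : {poly C}) : form :=
  \sum_(i < d.+1) q`_i *: ('X_0 ^+ i * 'X_1 ^+ (d - i)).

Lemma homogenizeX d q : homogenize d.+1 (q * 'X) = 'X_0 * homogenize d q.
Proof.
rewrite /homogenize big_ord_recl coefMX /= scale0r add0r mulr_sumr.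
apply: eq_bigr => i _; rewrite coefMX /= -scalerAr mulrA -exprS; congr (_ *: (_ * _)).
Qed.

Lemma homogenizeY d (q : {poly C}) : (size q <= d.+1)%N ->
  homogenize d.+1 q = 'X_1 * homogenize d q.
Proof.
move=> sq; rewrite /homogenize big_ord_recr /= nth_default // scale0r addr0 mulr_sumr.
apply: eq_bigr => i _; rewrite -scalerAr mulrCA -exprS subSn // -ltnS //.
Qed.

Lemma homogenizeB d (p q : {poly C}) :
  homogenize d (p - q) = homogenize d p - homogenize d q.
Proof.
by rewrite /homogenize -sumrB; apply: eq_bigr => i _; rewrite coefB scalerBl.
Qed.

Lemma homogenizeZ d c (q : {poly C}) : homogenize d (c *: q) = c *: homogenize d q.
Proof.
by rewrite /homogenize scaler_sumr; apply: eq_bigr => i _; rewrite coefZ scalerA.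
Qed.

Lemma mpolyX2 (m : 'X_{1..2}) : 'X_[m] = 'X_0 ^+ m 0 * 'X_1 ^+ m 1 :> form.
Proof.
rewrite mpolyXE_id !big_ord_recl big_ord0 mulr1; congr (_ * 'X__ ^+ m _); exact: val_inj.
Qed.

Lemma mdeg2 (m : 'X_{1..2}) : mdeg m = (m 0%R + m 1%R)%N.
Proof.
rewrite mdegE !big_ord_recl big_ord0 addn0; congr (_ + m _)%N; exact: val_inj.
Qed.

Lemma homog_homogenize d (f : form) : f \is d.-homog ->
  exists2 q : {poly C}, (size q <= d.+1)%N & f = homogenize d q.
Proof.
move=> /dhomogP fhom.
have fh m : m \in msupp f -> (m 0%R + m 1%R)%N = d.
  by move=> mf; rewrite -mdeg2; exact: fhom.
exists (\sum_(m <- msupp f) f@_m *: 'X^(m 0)).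
  rewrite (leq_trans (size_sum _ _ _)) //; apply/bigmax_leqP_seq => m mf _.
  rewrite (leq_trans (size_scale_leq _ _)) // size_polyXn ltnS.
  by rewrite -(fh m mf) leq_addr.
rewrite [LHS]mpolyE /homogenize.
under [RHS]eq_bigr => i _ do rewrite coef_sum scaler_suml.
rewrite exchange_big /= !big_seq; apply: eq_bigr => m mf.
have lm : (m 0%R < d.+1)%N by rewrite ltnS -(fh m mf) leq_addr.
rewrite (bigD1 (Ordinal lm)) //= big1 ?addr0 => [|i /negPf ni].
  rewrite coefZ coefXn eqxx mulr1 -(fh m mf) addKn mpolyX2 //.
rewrite coefZ coefXn (_ : _ == _ = false) ?mulr0 ?scale0r //.
Qed.

(** Induction on the degree: if the degree of [q] drops, then [Y] splits off,
    otherwise a root of [q] provides a linear factor. *)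
Lemma homogenize_split d (q : {poly C}) : (size q <= d.+1)%N ->
  exists c (s : seq 'cV[C]_2), [/\ size s = d, all (fun v => v != 0) s &
    homogenize d q = c *: \prod_(v <- s) lform v].
Proof.
elim: d q => [|d IH] q sq.
  exists q`_0, [::]; split=> //.
  by rewrite /homogenize big_ord1 !expr0 mulr1 big_nil.
have [sq'|sq'] := leqP (size q) d.+1.
  have [c [s [ss s0 E]]] := IH q sq'.
  exists c, (cvec2 (-1) 0 :: s); split; rewrite /= ?ss //.
    rewrite s0 andbT; apply/eqP => /colP/(_ 0); rewrite cvec2_0 mxE => /eqP.
    by rewrite oppr_eq0 oner_eq0.
  rewrite homogenizeY // E big_cons /lform cvec2_0 cvec2_1 scale0r sub0r.
  by rewrite scaleN1r opprK -scalerAr.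
have : size q != 1 by rewrite gtn_eqF // (leq_trans _ sq').
move=> /closed_rootP[r /factor_theorem[q' qE]].
have q'0 : q' != 0 by apply: contraTneq sq' => q'0; rewrite qE q'0 mul0r size_poly0.
have sq2 : (size q' <= d.+1)%N.
  by move: sq; rewrite qE size_Mmonic ?monicXsubC // size_XsubC addn2.
have [c [s [ss s0 E]]] := IH q' sq2.
exists c, (cvec2 r 1 :: s); split; rewrite /= ?ss //.
  rewrite s0 andbT; apply/eqP => /colP/(_ 1); rewrite cvec2_1 mxE => /eqP.
  by rewrite oner_eq0.
rewrite qE mulrBr homogenizeB homogenizeX [q' * _%:P]mulrC mul_polyC homogenizeZ homogenizeY //.
by rewrite big_cons /lform cvec2_0 cvec2_1 scale1r scalerAl -mulrBl E scalerAr.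
Qed.

Definition root_form (s : seq 'cV[R]_3) : form := \prod_(p <- s) lform (line p).

Definition has_divisor (f : form) (s : seq 'cV[R]_3) : Prop :=
  all (@on_sphere R) s /\ exists2 c : C, c != 0 & f = c *: root_form s.

Lemma lform_bloch (v : 'cV[C]_2) : v != 0 ->
  exists2 c, c != 0 & lform v = c *: lform (line (bloch v)).
Proof.
move=> v0; set w := line _; have w0 : w != 0 := line_neq0 _.
have /eqP : bloch w = bloch v by rewrite bloch_line // bloch_on_sphere.
rewrite bloch_eq // => /eqP/(det2_eq0P w0)[c cE]; exists c; last by rewrite cE lformZ.
by apply: contraNneq v0 => c0; rewrite cE c0 scale0r.
Qed.

Lemma divisor_exists d f : f != 0 -> f \is d.-homog ->
  exists2 s, has_divisor f s & size s = d.
Proof.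
move=> f0 /homog_homogenize[q sq fE]; move: f0; rewrite {}fE.
have [c [s [<- s0 ->]]] := homogenize_split sq => f0.
have c0 : c != 0 by apply: contraNneq f0 => ->; rewrite scale0r.
exists (map (@bloch R) s); last by rewrite size_map.
split; first by apply/allP => p /mapP[v /(allP s0) v0 ->]; exact: bloch_on_sphere.
suff [b b0 ->] : exists2 b, b != 0 &
    \prod_(v <- s) lform v = b *: root_form (map (@bloch R) s).
  by exists (c * b); rewrite ?mulf_neq0 // scalerA.
rewrite /root_form {f0 sq}; elim: s s0 => [|v s IH] /=.
  by exists 1; rewrite ?oner_eq0 // !big_nil scale1r.
case/andP=> /lform_bloch[a a0 aE] /IH[b b0 bE].
exists (a * b); rewrite ?mulf_neq0 // !big_cons aE bE.
by rewrite -scalerAr -scalerAl scalerA mulrC.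
Qed.

Lemma root_form_cons p s : root_form (p :: s) = lform (line p) * root_form s.
Proof. by rewrite /root_form big_cons. Qed.

Lemma root_form_cat s t : root_form (s ++ t) = root_form s * root_form t.
Proof. by rewrite /root_form big_cat. Qed.

Lemma root_form_perm s t : perm_eq s t -> root_form s = root_form t.
Proof. exact: perm_big. Qed.

Lemma root_form_neq0 s : root_form s != 0.
Proof. by rewrite prodf_seq_neq0; apply/allP => p _; rewrite lform_neq0 ?line_neq0. Qed.

Lemma root_form_homog s : root_form s \is (size s).-homog.
Proof.
elim: s => [|p s IH]; first by rewrite /root_form big_nil dhomog1.
by rewrite root_form_cons -[size _]/(1 + size s)%N dhomogM ?lform_homog.
Qed.

Lemma ev_root_form_eq0 s v : all (@on_sphere R) s -> v != 0 ->
  (ev (root_form s) v == 0) = (bloch v \in s).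
Proof.
move=> + v0; elim: s => [_|p s IH] /=.
  by rewrite /root_form big_nil /ev meval1 oner_eq0.
case/andP=> ps /IH {}IH; rewrite root_form_cons evM mulf_eq0 IH.
rewrite ev_lform oppr_eq0 -bloch_eq ?line_neq0 // bloch_line //.
by rewrite inE eq_sym.
Qed.

Lemma has_divisor_neq0 f s : has_divisor f s -> f != 0.
Proof. by case=> _ [c c0 ->]; rewrite scaler_eq0 negb_or c0 root_form_neq0. Qed.

Lemma has_divisor_homog f s : has_divisor f s -> f \is (size s).-homog.
Proof. by case=> _ [c c0 ->]; rewrite rpredZ // root_form_homog. Qed.

Lemma vanishes_at_divisor f s v : has_divisor f s -> v != 0 ->
  (vanishes_at f v <-> bloch v \in s).
Proof.
case=> ss [c c0 ->] v0; rewrite -(ev_root_form_eq0 ss v0) /vanishes_at -/(ev _ v) evZ.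
by split=> [/eqP|/eqP->]; rewrite ?mulr0 // mulf_eq0 (negPf c0).
Qed.

(** The zeros of both sides agree, so a common linear factor can be cancelled.
    *)
Lemma root_form_inj s t (c : C) : all (@on_sphere R) s -> all (@on_sphere R) t -> c != 0 ->
  root_form s = c *: root_form t -> perm_eq s t.
Proof.
move=> + + c0; elim: s t => [|p s IH] t /=.
  case: t => // q t _ /= /andP[qs _] E; have := ev_root_form_eq0 (s := [::]) isT (line_neq0 q).
  rewrite in_nil E evZ root_form_cons evM ev_lform.
  by rewrite det2vv oppr0 mul0r mulr0 eqxx.
case/andP=> ps ss ts E.
have pt : p \in t.
  rewrite -(bloch_line ps) -(ev_root_form_eq0 ts) ?line_neq0 //.
  rewrite -(mulrI_eq0 _ (mulfI c0)) -evZ -E ev_root_form_eq0 ?line_neq0 //=.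
    by rewrite bloch_line // mem_head.
  by rewrite ps.
have pE := perm_to_rem pt; rewrite perm_sym (perm_trans pE) // perm_cons perm_sym.
apply: IH => //; first by apply/allP => x /mem_rem /(allP ts).
apply: (mulfI (lform_neq0 (line_neq0 p))).
by rewrite -root_form_cons E (root_form_perm pE) root_form_cons scalerAr.
Qed.

Lemma divisor_unique f g s t (c : C) : c != 0 -> has_divisor f s -> has_divisor g t ->
  f = c *: g -> perm_eq s t.
Proof.
move=> c0 [ss [a a0 ->]] [ts [b b0 ->]]; rewrite scalerA => E.
apply: (@root_form_inj _ _ (a^-1 * (c * b))) => //.
  by rewrite !mulf_neq0 ?invr_eq0.
by rewrite -scalerA -E scalerA mulVf // scale1r.
Qed.

Lemma has_divisorM f g s t : has_divisor f s -> has_divisor g t ->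
  has_divisor (f * g) (s ++ t).
Proof.
move=> [ss [a a0 ->]] [ts [b b0 ->]]; split; first by rewrite all_cat ss ts.
exists (a * b); rewrite ?mulf_neq0 // root_form_cat.
by rewrite -scalerAr -scalerAl scalerA mulrC.
Qed.

Lemma has_divisor1 : has_divisor 1 [::].
Proof.
by split=> //; exists 1; rewrite ?oner_eq0 // /root_form big_nil scale1r.
Qed.

Lemma has_divisorX f s n : has_divisor f s ->
  has_divisor (f ^+ n) (flatten (nseq n s)).
Proof.
move=> fs; elim: n => [|n IH] /=; first exact: has_divisor1.
by rewrite exprS; apply: has_divisorM.
Qed.

Lemma has_divisor_prod (I : Type) (r : seq I) (f : I -> form) (s : I -> seq 'cV[R]_3) :
  (forall i, has_divisor (f i) (s i)) ->
  has_divisor (\prod_(i <- r) f i) (flatten [seq s i | i <- r]).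
Proof.
move=> fs; elim: r => [|i r IH] /=; first by rewrite big_nil; exact: has_divisor1.
by rewrite big_cons; apply: has_divisorM.
Qed.

Lemma has_divisor_perm f s t : perm_eq s t -> has_divisor f s -> has_divisor f t.
Proof.
move=> st [ss [c c0 ->]]; split; first by rewrite -(perm_all _ st).
by exists c; rewrite // (root_form_perm st).
Qed.

(** The quotient comes with its divisor, which also gives its degree. *)
Lemma divisor_dvd f g s t : has_divisor f s -> has_divisor g t ->
    (forall p, (count_mem p s <= count_mem p t)%N) ->
  exists h u, [/\ has_divisor h u, perm_eq t (s ++ u) & g = f * h].
Proof.
move=> [_ [a a0 ->]] [ts [b b0 ->]] st.
have [u tsu] : exists u, perm_eq t (s ++ u).
  elim: s t st {ts} => [|p s IH] t st; first by exists t.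
  have pt : p \in t by rewrite -has_pred1 has_count (leq_trans _ (st p)) //= eqxx.
  have pE := perm_to_rem pt; have [|u uE] := IH (rem p t).
    move=> q; have := st q; have /permP/(_ (pred1 q)) -> := pE.
    by rewrite /= leq_add2l.
  by exists u; rewrite (perm_trans pE) //= perm_cons.
exists ((a^-1 * b) *: root_form u), u; split=> //.
  split; last by exists (a^-1 * b); rewrite ?mulf_neq0 ?invr_eq0.
  by move: ts; rewrite (perm_all _ tsu) all_cat => /andP[].
rewrite (root_form_perm tsu) root_form_cat -scalerAr -scalerAl scalerA.
by rewrite mulrAC mulVf // mul1r.
Qed.

End BinaryForms.

(** * Characters of semi-invariant forms *)

Section Action.
Variable R : realType.
Notation C := R[i].
Notation M := (@SU2_to_SO3 R).
Notation form := {mpoly C[2]}.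
Implicit Types (f : form) (s : seq 'cV[R]_3).

Lemma actZ (g : 'M[C]_2) (c : C) f : act g (c *: f) = c *: act g f.
Proof. exact: linearZ. Qed.

Lemma act1 (g : 'M[C]_2) : act g 1 = 1 :> form.
Proof. exact: rmorph1. Qed.

Lemma actX (g : 'M[C]_2) f n : act g (f ^+ n) = act g f ^+ n.
Proof. exact: rmorphXn. Qed.

Lemma act_root_form g s : g \is SU2 R -> all (@on_sphere R) s ->
  exists2 c : C, c != 0 & act g (root_form s) = c *: root_form (map (mulmx (M g)) s).
Proof.
move=> gS; elim: s => [_|p s IH] /=.
  by exists 1; rewrite ?oner_eq0 // /root_form !big_nil act1 scale1r.
case/andP=> ps /IH[c c0 cE].
have gU := SU2_unit gS.
have gp0 : g *m line p != 0.
  by apply: contraNneq (line_neq0 p) => E; rewrite -(mulKmx gU (line p)) E mulmx0.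
have [b b0 bE] := lform_bloch gp0.
exists (b * c); rewrite ?mulf_neq0 // !root_form_cons act_mul cE act_lform // bE.
by rewrite bloch_act // bloch_line // -scalerAr -scalerAl scalerA mulrC.
Qed.

Lemma act_divisor g f s : g \is SU2 R -> has_divisor f s ->
  has_divisor (act g f) (map (mulmx (M g)) s).
Proof.
move=> gS [ss [c c0 ->]]; have [b b0 bE] := act_root_form gS ss.
split; last by exists (c * b); rewrite ?mulf_neq0 // actZ bE scalerA.
apply/allP => _ /mapP[q /(allP ss) qs ->].
by rewrite SO3_on_sphere // SU2_to_SO3_SO3.
Qed.

Lemma SO3_mul_inj (A : 'M[R]_3) n : A \is SO3 R -> injective (mulmx A : 'M_(3, n) -> _).
Proof.
by move=> AS x y E; rewrite -(mul1mx x) -(SO3_tr_mul AS) -mulmxA E mulmxA SO3_tr_mul ?mul1mx.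
Qed.

Lemma semi_inv_neq0 g f s (c : C) : g \is SU2 R -> has_divisor f s ->
  act g f = c *: f -> c != 0.
Proof.
move=> gS /has_divisor_neq0 f0 E; apply: contraNneq f0 => c0.
by rewrite -(act_eq0 _ (SU2_unit gS)) E c0 scale0r.
Qed.

(** The divisor of [act g f] is the image of that of [f] under the rotation,
    and a scalar does not change it. *)
Lemma semi_inv_count g f s (c : C) p : g \is SU2 R -> has_divisor f s ->
  act g f = c *: f -> count_mem (M g *m p) s = count_mem p s.
Proof.
move=> gS fs E; have c0 := semi_inv_neq0 gS fs E.
have /permP/(_ (pred1 (M g *m p))) <- := divisor_unique c0 (act_divisor gS fs) fs E.
rewrite count_map; apply: eq_count => q /=.
by rewrite (inj_eq (SO3_mul_inj (SU2_to_SO3_SO3 gS))).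
Qed.

Lemma semi_inv_of_perm g f s : g \is SU2 R -> has_divisor f s ->
  perm_eq (map (mulmx (M g)) s) s -> exists c : C, act g f = c *: f.
Proof.
move=> gS fs gs; have [_ [b b0 ->]] := act_divisor gS fs.
have [_ [c c0 ->]] := fs; exists (b / c).
by rewrite (root_form_perm gs) scalerA divfK.
Qed.

Lemma ev_root_formZ s (a : C) v :
  ev (root_form s) (a *: v) = a ^+ size s * ev (root_form s) v.
Proof.
elim: s => [|p s IH]; first by rewrite /root_form big_nil /ev !meval1 mulr1.
by rewrite root_form_cons !evM IH !ev_lform /det2 !mxE /= exprS; ring.
Qed.

Lemma root_form_split s p : root_form s =
  lform (line p) ^+ count_mem p s * root_form (filter (predC1 p) s).
Proof.
elim: s => [|q s IH] /=; first by rewrite mul1r.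
rewrite root_form_cons IH; case: eqP => [->|_] /=.
  by rewrite exprS mulrA.
by rewrite root_form_cons mulrCA.
Qed.

(** Write [f] as [L^c h], with [L] the linear form of [p] and [h] nonzero at
    [p].  Then [g] multiplies [L] by [z], and [h] takes at [g^-1 p] the value
    [z^-(deg h) h(p)]; compare both sides at [p]. *)
Lemma semi_inv_character g f s (c z : C) p :
  g \is SU2 R -> has_divisor f s -> act g f = c *: f -> on_sphere p -> z != 0 ->
  g *m line p = z *: line p -> c * z ^+ size s = z ^+ (2 * count_mem p s).
Proof.
move=> gS [ss [a a0 ->]] + ps z0 gz; set v := line p.
have v0 : v != 0 := line_neq0 p.
set b := count_mem p s; set t := filter (predC1 p) s; set h := root_form t.
have sz : (size s = b + size t)%N.
  by rewrite /t size_filter count_predC.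
have h0 : ev h v != 0.
  rewrite ev_root_form_eq0 //; last by apply/allP => q; rewrite mem_filter => /andP[_ /(allP ss)].
  by rewrite bloch_line // mem_filter /= eqxx.
rewrite actZ scalerA mulrC -scalerA => /(scalerI a0).
rewrite (root_form_split s p) -/b -/t -/h act_mul actX act_lform // gz lformZ.
rewrite exprZn -scalerAl scalerAr [in RHS]scalerAr => E.
have {}E := mulfI (expf_neq0 b (lform_neq0 v0)) E.
have := congr1 (fun q : form => ev q v) E; rewrite !evZ ev_act.
have -> : invmx g *m v = z^-1 *: v.
  by apply: (canLR (mulKmx (SU2_unit gS))); rewrite -scalemxAr gz scalerA mulVf ?scale1r.
rewrite ev_root_formZ mulrA => /(mulIf h0) <-.
rewrite sz exprD mulnC muln2 -addnn exprD exprVn.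
by field; rewrite expf_neq0.
Qed.

End Action.

(** * Orbits, stabilisers and the exceptional points *)

Lemma sum_nat_of_bool (T : Type) (s : seq T) (P : pred T) :
  (\sum_(x <- s) P x)%N = count P s.
Proof. by rewrite -sum1_count [RHS]big_mkcond; apply: eq_bigr => x _; case: (P x). Qed.

Lemma card_fset_filter (T : choiceType) (A : {fset T}) (P : pred T) :
  #|` [fset x in A | P x]| = count P (enum_fset A).
Proof.
rewrite -size_filter; apply/perm_size/uniq_perm; rewrite ?filter_uniq ?fset_uniq //.
by move=> x; rewrite mem_filter [in LHS]inE /= inE /= andbC.
Qed.

Section Polyhedral.
Variables (R : realType) (Gamma : {fset 'M[R]_3}).
Hypothesis polG : polyhedral Gamma.
Notation C := R[i].
Notation M := (@SU2_to_SO3 R).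

Lemma polyhedral_SO3 A : A \in Gamma -> A \is SO3 R.
Proof. by case: polG => h _ _ _; exact: h. Qed.

Lemma polyhedral1 : 1%:M \in Gamma.
Proof. by case: polG. Qed.

Lemma polyhedralM A B : A \in Gamma -> B \in Gamma -> A *m B \in Gamma.
Proof. by case: polG => _ _ h _; exact: h. Qed.

Lemma SO3_inv (A : 'M[R]_3) : A \is SO3 R -> invmx A = A^T.
Proof.
move=> AS; have AU : A \in unitmx by case/SO3P: AS => _ dA; rewrite unitmxE dA unitr1.
by rewrite -[RHS]mulmx1 -(mulmxV AU) mulmxA SO3_tr_mul // mul1mx.
Qed.

Lemma polyhedralT A : A \in Gamma -> A^T \in Gamma.
Proof.
move=> AG; rewrite -SO3_inv ?polyhedral_SO3 //.
by case: polG => _ _ _; exact.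
Qed.

Lemma in_stabiliser p A : (A \in stabiliser Gamma p) = (A \in Gamma) && (A *m p == p).
Proof. by rewrite !inE /=. Qed.

Lemma sphere_orbitP p q : reflect (exists2 A, A \in Gamma & q = A *m p)
  (q \in sphere_orbit Gamma p).
Proof.
by rewrite /sphere_orbit; apply: (iffP (imfsetP _ _ _ _)) => -[A AG ->]; exists A.
Qed.

Lemma mem_sphere_orbit p : p \in sphere_orbit Gamma p.
Proof. by apply/sphere_orbitP; exists 1%:M; rewrite ?polyhedral1 ?mul1mx. Qed.

Lemma sphere_orbit_eq p q : q \in sphere_orbit Gamma p ->
  sphere_orbit Gamma q = sphere_orbit Gamma p.
Proof.
case/sphere_orbitP=> A AG ->; apply/fsetP => x.
apply/sphere_orbitP/sphere_orbitP => -[B BG ->].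
  by exists (B *m A); rewrite ?polyhedralM // mulmxA.
exists (B *m A^T); rewrite ?polyhedralM ?polyhedralT // !mulmxA.
by congr (_ *m _); rewrite -mulmxA SO3_tr_mul ?mulmx1 ?polyhedral_SO3.
Qed.

Lemma sphere_orbit_stable p q A : A \in Gamma ->
  (A *m q \in sphere_orbit Gamma p) = (q \in sphere_orbit Gamma p).
Proof.
move=> AG; have AS := polyhedral_SO3 AG.
apply/sphere_orbitP/sphere_orbitP => -[B BG E].
  exists (A^T *m B); rewrite ?polyhedralM ?polyhedralT //.
  by rewrite -mulmxA -E mulmxA SO3_tr_mul // mul1mx.
by exists (A *m B); rewrite ?polyhedralM // E mulmxA.
Qed.

Lemma sphere_orbit_on_sphere p q : on_sphere p -> q \in sphere_orbit Gamma p ->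
  on_sphere q.
Proof. by move=> ps /sphere_orbitP[A AG ->]; rewrite SO3_on_sphere ?polyhedral_SO3. Qed.

Lemma perm_translate A : A \in Gamma ->
  perm_eq (map (mulmx A) (enum_fset Gamma)) (enum_fset Gamma).
Proof.
move=> AG; have AS := polyhedral_SO3 AG.
apply: uniq_perm; rewrite ?(map_inj_uniq (SO3_mul_inj AS)) ?fset_uniq //.
move=> B; apply/mapP/idP => [[D DG ->]|BG]; first exact: polyhedralM.
exists (A^T *m B); first exact: polyhedralM (polyhedralT AG) BG.
by rewrite mulmxA SO3_mul_tr // mul1mx.
Qed.

Lemma card_stabiliser p : #|` stabiliser Gamma p| = count (fun A => A *m p == p) (enum_fset Gamma).
Proof. exact: card_fset_filter. Qed.

(** Double counting of the pairs [(A, q)] with [A p = q]; each fibre is a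
    translate of the stabiliser. *)
Lemma orbit_stabiliser p :
  (#|` sphere_orbit Gamma p| * #|` stabiliser Gamma p|)%N = #|` Gamma|.
Proof.
have fiber q : q \in sphere_orbit Gamma p ->
    count (fun A => A *m p == q) (enum_fset Gamma) = #|` stabiliser Gamma p|.
  case/sphere_orbitP=> B BG ->; have BS := polyhedral_SO3 BG.
  have /permP <- := perm_translate BG; rewrite card_stabiliser count_map.
  by apply: eq_count => A /=; rewrite -mulmxA (inj_eq (SO3_mul_inj BS)).
transitivity (\sum_(q <- sphere_orbit Gamma p) \sum_(A <- Gamma) (A *m p == q))%N.
  rewrite big_seq; under eq_bigr => q qp do rewrite sum_nat_of_bool fiber //.
  by rewrite -big_seq big_const_seq count_predT iter_addn_0 mulnC.
rewrite exchange_big /= big_seq.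
transitivity (\sum_(A <- Gamma | A \in Gamma) 1)%N; last first.
  by rewrite -big_seq sum1_size.
apply: eq_bigr => A AG; under eq_bigr => q _ do rewrite eq_sym.
rewrite sum_nat_of_bool count_uniq_mem ?fset_uniq //.
by rewrite (_ : _ \in _) //; apply/sphere_orbitP; exists A.
Qed.

Lemma card_polyhedral_gt0 : (0 < #|` Gamma|)%N.
Proof. by rewrite cardfs_gt0; apply/fset0Pn; exists 1%:M; exact: polyhedral1. Qed.

Lemma card_stabiliser_gt0 p : (0 < #|` stabiliser Gamma p|)%N.
Proof.
rewrite cardfs_gt0; apply/fset0Pn; exists 1%:M.
by rewrite in_stabiliser polyhedral1 mul1mx eqxx.
Qed.

(** Lagrange's theorem for an abelian group: multiplication by one angle
    permutes the angles of the stabiliser, hence preserves their product. *)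
Lemma angle_unity p A : on_sphere p -> A \in stabiliser Gamma p ->
  angle p A ^+ #|` stabiliser Gamma p| = 1.
Proof.
move=> ps; set G := stabiliser Gamma p => AG.
have SG B : B \in G -> B \is SO3 R /\ B *m p = p.
  by rewrite in_stabiliser => /andP[/polyhedral_SO3 ? /eqP].
have [AS Ap] := SG A AG.
have tG : perm_eq (map (mulmx A) (enum_fset G)) (enum_fset G).
  apply: uniq_perm; rewrite ?(map_inj_uniq (SO3_mul_inj AS)) ?fset_uniq //.
  move=> B; apply/mapP/idP => [[D DG ->]|BG].
    move: AG (DG); rewrite !in_stabiliser => /andP[AG _] /andP[DG' _].
    by have [_ Dp] := SG D DG; rewrite polyhedralM //= -mulmxA Dp Ap.
  exists (A^T *m B); last by rewrite mulmxA SO3_mul_tr // mul1mx.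
  have [_ Bp] := SG B BG; move: AG BG; rewrite !in_stabiliser => /andP[AG _] /andP[BG _].
  by rewrite polyhedralM ?polyhedralT //= -mulmxA Bp -{1}Ap mulmxA SO3_tr_mul // mul1mx.
have n0 : \prod_(B <- G) angle p B != 0.
  rewrite prodf_seq_neq0; apply/allP => B BG; apply/implyP => _.
  by have [BS Bp] := SG B BG; exact: angle_neq0.
apply: (mulIf n0); rewrite mul1r -[RHS](perm_big _ tG) big_map.
rewrite [RHS]big_seq; under [RHS]eq_bigr => B BG.
  have [BS Bp] := SG B BG; rewrite angleM //; over.
by rewrite -big_seq big_split /= big_const_seq count_predT -Monoid.iteropE.
Qed.

(** Angles about [p] determine the rotation, so the stabiliser has as many
    angles as its order, all of them roots of unity of that order. *)
Lemma stabiliser_prim_angle p : on_sphere p -> exists2 A, A \in stabiliser Gamma p &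
  (#|` stabiliser Gamma p|).-primitive_root (angle p A).
Proof.
move=> ps; set G := stabiliser Gamma p.
have : has (#|` G|).-primitive_root (map (angle p) (enum_fset G)).
  apply: cyclic.has_prim_root; rewrite ?card_stabiliser_gt0 ?size_map //.
    by apply/allP => _ /mapP[A AG ->]; apply/unity_rootP; exact: angle_unity.
  rewrite map_inj_in_uniq ?fset_uniq // => A B.
  rewrite !in_stabiliser => /andP[/polyhedral_SO3 AS /eqP Ap] /andP[/polyhedral_SO3 BS /eqP Bp].
  exact: angle_inj.
by case/hasP=> _ /mapP[A AG ->] prim; exists A.
Qed.

End Polyhedral.

Section ExceptionalOrbits.
Variables (R : realType) (Gamma : {fset 'M[R]_3}).
Hypothesis polG : polyhedral Gamma.
Variables (Omega : finType) (So : Omega -> {fset 'cV[R]_3}) (nu : Omega -> nat).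
Hypothesis So_inj : injective So.
Hypothesis SoP : forall T, is_exceptional_orbit Gamma T <-> exists i, T = So i.
Hypothesis nuP : forall i x, x \in So i -> #|` stabiliser Gamma x| = nu i.

Lemma So_orbit i p : p \in So i -> on_sphere p /\ So i = sphere_orbit Gamma p.
Proof.
have [|q [qs E _]] := (SoP (So i)).2; first by exists i.
rewrite E => pq; split; first exact: sphere_orbit_on_sphere pq.
by rewrite (sphere_orbit_eq polG pq).
Qed.

Lemma So_nonempty i : exists p, p \in So i.
Proof.
have [|q [_ -> _]] := (SoP (So i)).2; first by exists i.
by exists q; exact: mem_sphere_orbit.
Qed.

Lemma card_So i : (#|` So i| * nu i)%N = #|` Gamma|.
Proof.
have [p pi] := So_nonempty i; have [_ E] := So_orbit pi.
by rewrite E -(nuP pi) orbit_stabiliser.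
Qed.

Lemma nu_gt0 i : (0 < nu i)%N.
Proof. by have [p pi] := So_nonempty i; rewrite -(nuP pi) card_stabiliser_gt0. Qed.

Lemma So_disjoint i j p : p \in So i -> p \in So j -> i = j.
Proof.
by move=> /So_orbit[_ Ei] /So_orbit[_ Ej]; apply: So_inj; rewrite Ei Ej.
Qed.

Lemma exceptional_in_So p : on_sphere p -> #|` stabiliser Gamma p| != 1%N ->
  exists i, p \in So i.
Proof.
move=> ps n1; have [|i E] := (SoP (sphere_orbit Gamma p)).1.
  by exists p; split=> //; apply: contraNneq n1 => ->; rewrite cardfs1.
by exists i; rewrite -E mem_sphere_orbit.
Qed.

Lemma sum_mem_So (n : Omega -> nat) i p : p \in So i ->
  (\sum_j n j * (p \in So j))%N = n i.
Proof.
move=> pi; rewrite (bigD1 i) //= pi muln1 big1 ?addn0 // => j ji.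
case: (boolP (p \in So j)) => [pj|_]; last by rewrite muln0.
by rewrite (So_disjoint pi pj) eqxx in ji.
Qed.

(** Double counting of the pairs of a nontrivial element of the group and a
    fixed point; every such fixed point is exceptional, and each element has
    two of them. *)
Lemma riemann_hurwitz :
  (\sum_i #|` So i| * (nu i).-1 = 2 * (#|` Gamma|).-1)%N.
Proof.
(* the stabiliser without the identity *)
pose moving (p : 'cV[R]_3) (A : 'M[R]_3) := (A != 1%:M) && (A *m p == p).
have stabE i p : p \in So i -> (nu i).-1 = count (moving p) (enum_fset Gamma).
  move=> pi; rewrite -(nuP pi) card_stabiliser.
  have G1 := polyhedral1 polG.
  rewrite (permP (perm_to_rem G1)) /= mul1mx eqxx add1n /=.
  rewrite (permP (perm_to_rem G1) (moving p)) /= {1}/moving eqxx add0n.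
  apply: eq_in_count => A; rewrite (rem_filter _ (fset_uniq _)) mem_filter.
  by rewrite /moving /= => /andP[->].
transitivity (\sum_(A <- Gamma) \sum_i \sum_(p <- So i) moving p A)%N.
  rewrite exchange_big /=; apply: eq_bigr => i _; rewrite exchange_big /= big_seq.
  under [RHS]eq_bigr => p pi do rewrite sum_nat_of_bool -(stabE i) //.
  by rewrite -big_seq big_const_seq count_predT iter_addn_0 mulnC.
have G1 := polyhedral1 polG.
have countE (A : 'M[R]_3) : A \in Gamma ->
   (\sum_i \sum_(p <- So i) moving p A = 2 * (A != 1%:M))%N.
  move=> AG; have AS := polyhedral_SO3 polG AG; rewrite /moving.
  have [->|A1] := eqVneq A; first by rewrite big1 // => i _; rewrite big1.
  have [q [qs Nqs qNq fixE]] := SO3_two_fixpoints AS A1.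
  have inSo p : on_sphere p -> (p == q) || (p == - q) -> (\sum_i (p \in So i) = 1)%N.
    move=> ps; rewrite -fixE // => Ap.
    have [|i pi] := exceptional_in_So ps; last first.
      by rewrite -[RHS](sum_mem_So (fun=> 1%N) pi); apply: eq_bigr => j _; rewrite mul1n.
    apply: contraNneq A1 => /eqP/cardfs1P[B SB].
    have : 1%:M \in stabiliser Gamma p by rewrite in_stabiliser G1 mul1mx eqxx.
    have : A \in stabiliser Gamma p by rewrite in_stabiliser AG Ap.
    by rewrite SB !inE => /eqP-> /eqP->.
  transitivity (\sum_i (q \in So i) + \sum_i (- q \in So i))%N; last first.
    by rewrite !inSo ?eqxx ?orbT.
  rewrite -big_split /=; apply: eq_bigr => i _.
  rewrite -!count_uniq_mem ?fset_uniq // -!sum_nat_of_bool -big_split /=.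
  rewrite big_seq [RHS]big_seq; apply: eq_bigr => p /So_orbit[ps _].
  rewrite fixE //=; case: eqP => [->|_]; last by rewrite add0n.
  by rewrite (negPf qNq).
rewrite big_seq (eq_bigr _ countE) -big_seq -big_distrr /=; congr (2 * _)%N.
rewrite sum_nat_of_bool (permP (perm_to_rem G1)) /= eqxx add0n.
rewrite -(size_rem G1) -[RHS]count_predT; apply: eq_in_count => A.
by rewrite (rem_filter _ (fset_uniq _)) mem_filter /= => /andP[->].
Qed.

Lemma sum_card_So :
  ((\sum_i #|` So i|)%:Z = 2 - 2 * #|` Gamma|%:Z + #|Omega|%:Z * #|` Gamma|%:Z).
Proof.
have E i : #|` So i|%:Z = #|` Gamma|%:Z - (#|` So i| * (nu i).-1)%:Z.
  by rewrite -(card_So i) -{1 2}(prednK (nu_gt0 i)) mulnS PoszD addrK.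
have := riemann_hurwitz; move=> /(congr1 Posz).
rewrite -[(#|` Gamma|).-1]subn1 PoszM -subzn ?card_polyhedral_gt0 // => RH.
rewrite (big_morph Posz PoszD (erefl _)) (eq_bigr _ (fun i _ => E i)) sumrB.
rewrite -[X in _ - X](big_morph Posz PoszD (erefl _)) RH sumr_const.
rewrite -[_ *+ _]mulr_natl natz; ring.
Qed.

Lemma half_residueE n (h : int) : (0 < n)%N ->
  (half_residue n (h * 2))%:Z = (h %% n%:Z)%Z.
Proof.
move=> n0; rewrite /half_residue mulzK // abszE ger0_norm // modz_ge0 //.
by rewrite eqz_nat -lt0n.
Qed.

(** Modulo the order of the group, [n(k)_i d_i] is [(k/2) d_i], since [nu_i
    d_i] is that order; and the sum of the [d_i] is congruent to 2. *)
Lemma residual_degree_dvd (k : int) : (2 %| k)%Z ->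
  (#|` Gamma|%:Z %| residual_degree So nu k)%Z.
Proof.
case/dvdzP=> h ->; rewrite /residual_degree.
have E i : (half_residue (nu i) (h * 2) * #|` So i|)%:Z =
    h * #|` So i|%:Z - (h %/ (nu i)%:Z)%Z * #|` Gamma|%:Z.
  rewrite PoszM half_residueE ?nu_gt0 // -(card_So i) PoszM /modz; ring.
rewrite (eq_bigr _ (fun i _ => E i)) sumrB -mulr_sumr -mulr_suml.
rewrite -(big_morph Posz PoszD (erefl _)) sum_card_So.
apply/dvdzP; exists (h * 2 - h * #|Omega|%:Z + \sum_i (h %/ (nu i)%:Z)%Z); ring.
Qed.

End ExceptionalOrbits.

(** * Invariance read on divisors *)

Lemma tofrac_divM (A : idomainType) (a b c d : A) :
  (a * b)%:F / (c * d)%:F = a%:F / c%:F * (b%:F / d%:F).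
Proof. by rewrite !tofracM mulf_div. Qed.

Section Fractions.
Variable R : realType.
Notation C := R[i].
Notation form := {mpoly C[2]}.

Lemma frac_act_tofrac (g : 'M[C]_2) (f : form) : g \in unitmx ->
  frac_act g f%:F = (act g f)%:F.
Proof.
move=> gU; have := frac_act_frac f gU (oner_neq0 _).
by rewrite act1 rmorph1 !divr1.
Qed.

Lemma frac_actM (g : 'M[C]_2) : g \in unitmx ->
  {morph frac_act g : x y / x * y}.
Proof.
have fracP x : exists f h : form, h != 0 /\ x = f%:F / h%:F.
  by exists \n_(repr x), \d_(repr x); split; [exact: denom_ratioP|exact: frac_repr].
move=> gU x y; have [f [h [h0 ->]]] := fracP x; have [f' [h' [h'0 ->]]] := fracP y.
have -> : f%:F / h%:F * (f'%:F / h'%:F) = (f * f')%:F / (h * h')%:F.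
  by rewrite tofrac_divM.
rewrite (frac_act_frac _ gU (mulf_neq0 h0 h'0)).
rewrite (frac_act_frac _ gU h0) (frac_act_frac _ gU h'0) !act_mul.
exact: tofrac_divM.
Qed.

(** Integer exponents are needed because [k] may be negative. *)
Lemma prim_root_int (F : fieldType) n (w : F) (j : int) :
  n.-primitive_root w -> w ^ j = 1 -> (n%:Z %| j)%Z.
Proof.
move=> prim; case: j => m.
  by rewrite -exprnP => /eqP; rewrite -(prim_order_dvd prim).
rewrite NegzE -exprnN => /eqP; rewrite invr_eq1 -(prim_order_dvd prim) => d.
by rewrite rpredN.
Qed.

Lemma unity_root_int (F : fieldType) n (w : F) (j : int) :
  w ^+ n = 1 -> (n%:Z %| j)%Z -> w ^ j = 1.
Proof. by move=> wn /dvdzP[q ->]; rewrite mulrC -exprz_exp -exprnP wn exp1rz. Qed.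

(** This excludes [P = 0], whose zeros would fill the sphere. *)
Lemma sphere_infinite (S : {fset 'cV[R]_3}) : exists v : 'cV[C]_2, v != 0 /\ bloch v \notin S.
Proof.
pose v (n : nat) : 'cV[C]_2 := cvec2 1 n%:R.
have v0 n : v n != 0.
  by apply/eqP => /colP/(_ 0) /eqP; rewrite cvec2_0 mxE oner_eq0.
have v_inj : injective (fun n => bloch (v n)).
  move=> m n /eqP; rewrite bloch_eq // /det2 !cvec2_0 !cvec2_1 mul1r mulr1 subr_eq0.
  by rewrite eqr_nat => /eqP.
set s := map (fun n => bloch (v n)) (iota 0 (#|` S|).+1).
have /allPn[_ /mapP[n _ ->] nS] : ~~ all (mem S) s.
  apply/negP => /allP sS; have us : uniq s by rewrite map_inj_uniq // iota_uniq.
  by have := uniq_leq_size us sS; rewrite size_map size_iota ltnn.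
by exists (v n).
Qed.

Lemma sum_count_mem (T : eqType) (S s : seq T) : uniq S -> {subset s <= S} ->
  (\sum_(q <- S) count_mem q s)%N = size s.
Proof.
move=> uS sS; under eq_bigr => q _ do rewrite -sum_nat_of_bool.
rewrite exchange_big /= big_seq.
transitivity (\sum_(x <- s | x \in s) 1)%N; last by rewrite -big_seq sum1_size.
apply: eq_bigr => x /sS xS; under eq_bigr => q _ do rewrite eq_sym.
by rewrite sum_nat_of_bool count_uniq_mem // xS.
Qed.

End Fractions.

Section Main.
Variables (R : realType) (Gamma : {fset 'M[R]_3}).
Notation C := R[i].
Notation M := (@SU2_to_SO3 R).
Notation form := {mpoly C[2]}.
Hypothesis polG : polyhedral Gamma.
Variables (S : {fset 'cV[R]_3}) (P : form).
Hypothesis hS : is_orbit Gamma S.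
Hypothesis hP_deg : P \is #|` Gamma|.-homog.
Hypothesis hP_inv : relatively_invariant Gamma P.
Hypothesis hP_zero : has_zero_set S P.

Notation stab p := (#|` stabiliser Gamma p|).

Lemma binaryP g : g \is binary Gamma -> g \is SU2 R /\ M g \in Gamma.
Proof. by move/andP. Qed.

Lemma binary_lift A : A \in Gamma -> exists2 g, g \is binary Gamma & M g = A.
Proof.
move=> AG; have [g gS gA] := SU2_to_SO3_surj (polyhedral_SO3 polG AG).
by exists g => //; apply/andP; rewrite gA.
Qed.

Lemma P_neq0 : P != 0.
Proof.
have [v [v0]] := sphere_infinite S; apply: contraNneq => P0.
by apply/(hP_zero v0); rewrite P0 /vanishes_at meval0.
Qed.

(** The zeros of [P] form one orbit and have a common multiplicity, which the
    degree forces to be the order of a stabiliser. *)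
Lemma P_divisor : exists2 s, has_divisor P s &
  size s = #|` Gamma| /\ forall p, on_sphere p -> (stab p %| count_mem p s)%N.
Proof.
have [s Ps ss] := divisor_exists P_neq0 hP_deg; exists s => //; split=> // p ps.
have sS q : on_sphere q -> (q \in s) = (q \in S).
  move=> qs; apply/idP/idP => qq.
    by rewrite -(bloch_line qs); apply/(hP_zero (line_neq0 q))/(vanishes_at_divisor Ps (line_neq0 q)); rewrite bloch_line.
  by rewrite -(bloch_line qs); apply/(vanishes_at_divisor Ps (line_neq0 q))/(hP_zero (line_neq0 q)); rewrite bloch_line.
have [pS|pS] := boolP (p \in S); last first.
  by move: pS; rewrite -sS // => /count_memPn ->; rewrite dvdn0.
have SE : S = sphere_orbit Gamma p.
  by case: hS => x xs E; move: pS; rewrite E => /(sphere_orbit_eq polG) ->.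
have cE q : q \in S -> count_mem q s = count_mem p s.
  rewrite SE => /sphere_orbitP[A AG ->]; have [g gB <-] := binary_lift AG.
  have [c] := hP_inv gB; case: (binaryP gB) => gS _; exact: semi_inv_count.
have : (#|` S| * count_mem p s)%N = (#|` S| * stab p)%N.
  rewrite {2}SE orbit_stabiliser // -ss -(@sum_count_mem _ (enum_fset S) s) ?fset_uniq //.
    rewrite [in RHS]big_seq (eq_bigr _ cE) -big_seq big_const_seq count_predT.
    by rewrite iter_addn_0 mulnC.
  by move=> q qs; rewrite -sS //; case: Ps => /allP/(_ q qs).
move/eqP; rewrite eqn_pmul2l => [/eqP->//|].
by rewrite cardfs_gt0; apply/fset0Pn; exists p.
Qed.

(** The last equation says that [z^2] is an angle of the stabiliser of [p]. *)
Lemma binary_eigen g p : g \is binary Gamma -> on_sphere p -> M g *m p = p ->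
  exists z : C, [/\ z != 0, g *m line p = z *: line p &
    (z ^+ 2) ^+ stab p = 1].
Proof.
move=> /binaryP[gS gG] ps gp; have [z z0 gz] := eigen_of_fix gS ps gp.
exists z; split=> //; rewrite -(angle_eigen gS ps gz) angle_unity //.
by rewrite in_stabiliser gG gp eqxx.
Qed.

(** The right-hand side of [semi_inv_character] is 1 for [P], whose
    multiplicities are multiples of the order of the stabiliser. *)
Lemma P_character g p (a z : C) m : g \is binary Gamma -> on_sphere p -> z != 0 ->
  g *m line p = z *: line p -> (z ^+ 2) ^+ stab p = 1 -> act g P = a *: P ->
  a ^+ m = z ^ (- (m * #|` Gamma|)%:Z).
Proof.
move=> /binaryP[gS gG] ps z0 gz zn aE; have [s Ps [<- /(_ p ps)/dvdnP[q qE]]] := P_divisor.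
rewrite -exprnN mulnC exprM -exprVn; congr (_ ^+ m).
apply: (mulIf (expf_neq0 (size s) z0)); rewrite (semi_inv_character gS Ps aE ps z0 gz).
by rewrite qE exprM (mulnC q) exprM zn expr1n mulVf ?expf_neq0.
Qed.

(** A generator of the stabiliser of [p] has a primitive root of unity as its
    angle, so the equality of the characters of [f] and [P^m] is a congruence
    between exponents. *)
Lemma counts_of_invariant f s m (h : int) : has_divisor f s ->
  (size s)%:Z - (m * #|` Gamma|)%:Z = h * 2 ->
  (forall g, g \is binary Gamma -> frac_act g (f%:F / (P ^+ m)%:F) = f%:F / (P ^+ m)%:F) ->
  forall p, on_sphere p -> ((stab p)%:Z %| h - (count_mem p s)%:Z)%Z.
Proof.
move=> fs deg inv p ps; have [A AS prim] := stabiliser_prim_angle polG ps.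
move: AS; rewrite in_stabiliser => /andP[AG /eqP Ap].
have [g gB gA] := binary_lift AG; have [gS gG] := binaryP gB.
have gp : M g *m p = p by rewrite gA.
have [z [z0 gz zn]] := binary_eigen gB ps gp.
move: prim; rewrite -gA (angle_eigen gS ps gz) => prim.
have [a aE] := hP_inv gB; have az := P_character m gB ps z0 gz zn aE.
have gU := SU2_unit gS; have P0 := P_neq0.
have fE : act g f = a ^+ m *: f.
  have := inv g gB; rewrite (frac_act_frac _ gU (expf_neq0 m P0)) actX aE exprZn => /eqP.
  have aP0 : a ^+ m *: P ^+ m != 0.
    by rewrite -exprZn expf_neq0 // -aE act_eq0.
  rewrite eqr_div ?tofrac_eq0 ?expf_neq0 // -!tofracM tofrac_eq => /eqP E.
  by apply: (mulIf (expf_neq0 m P0)); rewrite E -scalerAl -scalerAr.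
have := semi_inv_character gS fs fE ps z0 gz.
rewrite az !exprnP -expfzDr // addrC deg => E; apply: (prim_root_int prim).
rewrite [z ^+ 2]exprnP exprz_exp.
have -> : 2%:Z * (h - (count_mem p s)%:Z) = h * 2 - (2 * count_mem p s)%:Z.
  by rewrite PoszM; ring.
by rewrite expfzDr // E -expfzDr // subrr.
Qed.

(** Each [g] has a fixed point [p] on the sphere, and the congruence at that
    point makes the characters of [f] and [P^m] agree on [g]. *)
Lemma invariant_of_counts f s m (h : int) : has_divisor f s ->
  relatively_invariant Gamma f ->
  (size s)%:Z - (m * #|` Gamma|)%:Z = h * 2 ->
  (forall p, on_sphere p -> ((stab p)%:Z %| h - (count_mem p s)%:Z)%Z) ->
  forall g, g \is binary Gamma -> frac_act g (f%:F / (P ^+ m)%:F) = f%:F / (P ^+ m)%:F.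
Proof.
move=> fs finv deg cnt g gB; have [gS gG] := binaryP gB.
have [p ps gp] := SO3_has_fixpoint (polyhedral_SO3 polG gG).
have [z [z0 gz zn]] := binary_eigen gB ps gp.
have [a aE] := hP_inv gB; have az := P_character m gB ps z0 gz zn aE.
have gU := SU2_unit gS; have P0 := P_neq0.
have [b bE] := finv g gB.
have bz := semi_inv_character gS fs bE ps z0 gz.
have ab : b = a ^+ m.
  rewrite az; have := unity_root_int zn (cnt p ps); rewrite [z ^+ 2]exprnP exprz_exp.
  move=> E; apply: (mulIf (expf_neq0 (size s) z0)); rewrite bz !exprnP -expfzDr //.
  rewrite addrC deg.
  have -> : h * 2 = 2%:Z * (h - (count_mem p s)%:Z) + (2 * count_mem p s)%:Z.
    by rewrite PoszM; ring.
  by rewrite expfzDr // E mul1r.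
have aP0 : a ^+ m *: P ^+ m != 0.
  by rewrite -exprZn expf_neq0 // -aE act_eq0.
rewrite (frac_act_frac _ gU (expf_neq0 m P0)) actX aE exprZn bE ab; apply/eqP.
rewrite eqr_div ?tofrac_eq0 ?expf_neq0 // -!tofracM tofrac_eq.
by rewrite -scalerAl -scalerAr.
Qed.

End Main.

(** * The elements P_k *)

Section GroundForms.
Variables (R : realType) (Gamma : {fset 'M[R]_3}).
Notation C := R[i].
Notation M := (@SU2_to_SO3 R).
Notation form := {mpoly C[2]}.
Hypothesis polG : polyhedral Gamma.
Variables (Omega : finType) (So : Omega -> {fset 'cV[R]_3}) (nu : Omega -> nat).
Variable Po : Omega -> form.
Hypothesis So_inj : injective So.
Hypothesis SoP : forall T, is_exceptional_orbit Gamma T <-> exists i, T = So i.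
Hypothesis nuP : forall i x, x \in So i -> #|` stabiliser Gamma x| = nu i.
Hypothesis PoP : forall i, is_ground_form (So i) (Po i).

(** The degree leaves no room for other zeros or for multiplicities. *)
Lemma ground_form_divisor i : has_divisor (Po i) (So i).
Proof.
have [f0 fd fz] := PoP i; have [s fs ss] := divisor_exists f0 fd.
have sub : {subset enum_fset (So i) <= s}.
  move=> p pi; have [ps _] := So_orbit polG SoP pi.
  rewrite -(bloch_line ps); apply/(vanishes_at_divisor fs (line_neq0 p)).
  by apply: fz; rewrite ?line_neq0 // bloch_line.
apply: has_divisor_perm fs; rewrite perm_sym.
have szs : (size s <= size (enum_fset (So i)))%N by rewrite ss.
have [_ eqs] := uniq_min_size (fset_uniq (So i)) sub szs.
by apply: uniq_perm; rewrite ?fset_uniq // (leq_size_uniq (fset_uniq (So i)) sub szs).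
Qed.

Lemma relatively_invariantM (f h : form) : relatively_invariant Gamma f ->
  relatively_invariant Gamma h -> relatively_invariant Gamma (f * h).
Proof.
move=> fi hi g gB; have [a aE] := fi g gB; have [b bE] := hi g gB.
by exists (a * b); rewrite act_mul aE bE -scalerAr -scalerAl scalerA mulrC.
Qed.

Lemma relatively_invariant1 : relatively_invariant Gamma (1 : form).
Proof. by move=> g gB; exists 1; rewrite act1 scale1r. Qed.

Lemma relatively_invariantX (f : form) n : relatively_invariant Gamma f ->
  relatively_invariant Gamma (f ^+ n).
Proof.
move=> fi; elim: n => [|n IH]; first exact: relatively_invariant1.
by rewrite exprS; apply: relatively_invariantM.
Qed.

Lemma ground_form_inv i : relatively_invariant Gamma (Po i).
Proof.
move=> g /andP[gS gG]; apply: (semi_inv_of_perm gS (ground_form_divisor i)).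
have gS3 := SU2_to_SO3_SO3 gS; have [p pi] := So_nonempty polG SoP i.
have [_ SE] := So_orbit polG SoP pi.
apply: uniq_perm; rewrite ?(map_inj_uniq (SO3_mul_inj gS3)) ?fset_uniq //.
move=> q; apply/mapP/idP => [[x xi ->]|qi].
  by move: xi; rewrite SE sphere_orbit_stable.
exists ((M g)^T *m q); last by rewrite mulmxA SO3_mul_tr // mul1mx.
by move: qi; rewrite SE (sphere_orbit_stable polG) // polyhedralT.
Qed.

Definition ground_product (k : int) : form :=
  \prod_i Po i ^+ half_residue (nu i) k.

Definition ground_divisor (k : int) : seq 'cV[R]_3 :=
  flatten [seq flatten (nseq (half_residue (nu i) k) (enum_fset (So i)))
          | i <- index_enum Omega].

Lemma ground_product_divisor k : has_divisor (ground_product k) (ground_divisor k).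
Proof. by apply: has_divisor_prod => i; apply/has_divisorX/ground_form_divisor. Qed.

Lemma ground_product_inv k : relatively_invariant Gamma (ground_product k).
Proof.
rewrite /ground_product; elim/big_ind: _ => [|f h|i _].
- exact: relatively_invariant1.
- exact: relatively_invariantM.
- exact/relatively_invariantX/ground_form_inv.
Qed.

Lemma count_flatten_nseq (T : eqType) (a : pred T) (s : seq T) n :
  count a (flatten (nseq n s)) = (n * count a s)%N.
Proof. by elim: n => //= n IH; rewrite count_cat IH mulSn. Qed.

Lemma count_ground_divisor k (a : pred 'cV[R]_3) : count a (ground_divisor k) =
  (\sum_i half_residue (nu i) k * count a (enum_fset (So i)))%N.
Proof.
rewrite /ground_divisor count_flatten -map_comp sumnE big_map.
by apply: eq_bigr => i _ /=; rewrite count_flatten_nseq.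
Qed.

Lemma size_ground_divisor k : size (ground_divisor k) =
  (\sum_i half_residue (nu i) k * #|` So i|)%N.
Proof.
rewrite -count_predT count_ground_divisor.
by apply: eq_bigr => i _; rewrite count_predT.
Qed.

Lemma count_mem_ground k i p : p \in So i ->
  count_mem p (ground_divisor k) = half_residue (nu i) k.
Proof.
move=> pi; rewrite count_ground_divisor -[RHS](sum_mem_So polG So_inj SoP (fun j => half_residue (nu j) k) pi).
by apply: eq_bigr => j _; rewrite count_uniq_mem ?fset_uniq.
Qed.

Lemma count_mem_ground0 k p : (forall i, p \notin So i) ->
  count_mem p (ground_divisor k) = 0%N.
Proof.
move=> np; rewrite count_ground_divisor big1 // => j _.
by rewrite count_uniq_mem ?fset_uniq // (negPf (np j)) muln0.
Qed.

(** At a point with trivial stabiliser the congruence is empty; at a point of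
    [So i] the multiplicity is the residue itself. *)
Lemma ground_divisor_mod (h : int) p : on_sphere p ->
  ((#|` stabiliser Gamma p|)%:Z %| h - (count_mem p (ground_divisor (h * 2)))%:Z)%Z.
Proof.
move=> ps; have [->|n1] := eqVneq #|` stabiliser Gamma p| 1%N; first exact: dvd1z.
have [i pi] := exceptional_in_So polG SoP ps n1.
rewrite (count_mem_ground _ pi) half_residueE ?(nu_gt0 polG SoP nuP) // (nuP pi).
by apply/dvdzP; exists (h %/ nu i)%Z; rewrite /modz; ring.
Qed.

(** A residue is the least natural number in its class. *)
Lemma ground_divisor_le (h : int) s : all (@on_sphere R) s ->
  (forall p, on_sphere p ->
    ((#|` stabiliser Gamma p|)%:Z %| h - (count_mem p s)%:Z)%Z) ->
  forall p, (count_mem p (ground_divisor (h * 2)) <= count_mem p s)%N.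
Proof.
move=> ss cnt p; case: (pickP (fun i => p \in So i)) => [i pi|np]; last first.
  by rewrite count_mem_ground0 // => i; rewrite np.
have [ps _] := So_orbit polG SoP pi.
have := cnt p ps; rewrite (nuP pi) -eqz_mod_dvd => /eqP E.
rewrite (count_mem_ground _ pi) -lez_nat half_residueE ?(nu_gt0 polG SoP nuP) // E.
by rewrite modz_nat lez_nat leq_mod.
Qed.

Variables (S : {fset 'cV[R]_3}) (P : form).
Hypothesis hS : is_orbit Gamma S.
Hypothesis hP_deg : P \is #|` Gamma|.-homog.
Hypothesis hP_inv : relatively_invariant Gamma P.
Hypothesis hP_zero : has_zero_set S P.

Let P0 : P != 0 := P_neq0 hP_zero.

(** Two natural exponents avoid a case distinction on the sign of the
    exponent. *)
Lemma P_expz (l : int) : exists a b : nat, l = a%:Z - b%:Z /\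
  P%:F ^ l = (P ^+ a)%:F / (P ^+ b)%:F.
Proof.
case: l => n.
  by exists n, 0%N; rewrite subr0 expr0 tofrac1 divr1 tofracXn.
exists 0%N, n.+1; rewrite sub0r NegzE; split=> //.
by rewrite expr0 tofrac1 mul1r tofracXn -exprnN.
Qed.

Lemma P_pow_homog m e : P ^+ m \is e.-homog -> e = (m * #|` Gamma|)%N.
Proof.
move=> h; apply: (dhomog_uniq (expf_neq0 m P0) h).
by rewrite mulnC dhomogMn.
Qed.

Lemma P_elt_frac (h : int) : exists a b : nat,
  [/\ h * 2 = (size (ground_divisor (h * 2)))%:Z + (a * #|` Gamma|)%:Z - (b * #|` Gamma|)%:Z
    & P_elt Gamma So nu Po P (h * 2) =
      (P ^+ a * ground_product (h * 2))%:F / (P ^+ b)%:F].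
Proof.
have k2 : (2 %| h * 2)%Z by apply/dvdzP; exists h.
have [l lE] : exists l, residual_degree So nu (h * 2) = l * #|` Gamma|%:Z.
  exact/dvdzP/(residual_degree_dvd polG So_inj SoP nuP).
have G0 : #|` Gamma|%:Z != 0 by rewrite eqz_nat -lt0n card_polyhedral_gt0.
have [a [b [labE PlE]]] := P_expz l; exists a, b; split.
  have sE : residual_degree So nu (h * 2) = h * 2 - (size (ground_divisor (h * 2)))%:Z.
    by rewrite size_ground_divisor (big_morph Posz PoszD (erefl _)).
  rewrite -[LHS](subrK (size (ground_divisor (h * 2)))%:Z) -sE lE labE !PoszM; ring.
rewrite /P_elt k2 lE mulzK // PlE tofracM mulrAC; congr (_ * _ / _).
rewrite /ground_product rmorph_prod /=; apply: eq_bigr => i _.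
by rewrite tofracXn.
Qed.

Lemma P_elt_neq0 (h : int) : P_elt Gamma So nu Po P (h * 2) != 0.
Proof.
have [a [b [_ ->]]] := P_elt_frac h.
have Q0 := has_divisor_neq0 (ground_product_divisor (h * 2)).
by rewrite mulf_neq0 ?invr_eq0 ?tofrac_eq0 ?mulf_neq0 ?expf_neq0.
Qed.

Lemma P_elt_invariant (h : int) :
  invariant_part Gamma P (h * 2) (P_elt Gamma So nu Po P (h * 2)).
Proof.
have [a [b [deg ->]]] := P_elt_frac h.
have Qs := ground_product_divisor (h * 2).
have [sP Ps [sPs sPn]] := P_divisor polG hS hP_deg hP_inv hP_zero.
have fs := has_divisorM (has_divisorX a Ps) Qs.
have szf : size (flatten (nseq a sP) ++ ground_divisor (h * 2)) =
    (a * #|` Gamma| + size (ground_divisor (h * 2)))%N.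
  by rewrite size_cat -count_predT count_flatten_nseq count_predT sPs.
split.
  exists (P ^+ a * ground_product (h * 2)), b, (a * #|` Gamma| + size (ground_divisor (h * 2)))%N, (b * #|` Gamma|)%N.
  split=> //; first by rewrite -szf; exact: has_divisor_homog fs.
    by rewrite mulnC dhomogMn.
  by rewrite [RHS]deg PoszD; ring.
apply: (invariant_of_counts polG hS hP_deg hP_inv hP_zero fs (h := h)).
- by apply: relatively_invariantM; [exact: relatively_invariantX|exact: ground_product_inv].
- by rewrite szf [RHS]deg PoszD; ring.
move=> p ps; rewrite count_cat count_flatten_nseq PoszD opprD addrCA.
rewrite rpredD ?ground_divisor_mod // rpredN.
by rewrite dvdzE /= dvdn_mull // sPn.
Qed.

Lemma invariant_partM k l x y : invariant_part Gamma P k x ->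
  invariant_part Gamma P l y -> invariant_part Gamma P (k + l) (x * y).
Proof.
move=> [[f [m [d [e [fd Pe kE ->]]]]] xi] [[f' [m' [d' [e' [fd' Pe' lE ->]]]]] yi].
split.
  exists (f * f'), (m + m')%N, (d + d')%N, (e + e')%N; split.
  - exact: dhomogM.
  - by rewrite exprD dhomogM.
  - by rewrite -kE -lE !PoszD; ring.
  - by rewrite exprD tofrac_divM.
move=> g gB; have gU : g \in unitmx by case/andP: gB => /SU2_unit.
by rewrite frac_actM // xi // yi.
Qed.

(** Zero has degree [k] only through a representation whose denominator [P^m]
    has degree at least [-k]; the exponent [m = |k|] is large enough. *)
Lemma invariant_part0 k : invariant_part Gamma P k 0.
Proof.
split; last first.
  move=> g gB; have gU : g \in unitmx by case/andP: gB => /SU2_unit.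
  by rewrite -tofrac0 frac_act_tofrac // /act rmorph0.
exists 0, (absz k), (absz (k + (absz k * #|` Gamma|)%:Z)), (absz k * #|` Gamma|)%N.
split; rewrite ?tofrac0 ?mul0r ?rpred0 //.
  by rewrite mulnC dhomogMn.
rewrite gez0_abs ?addrK //.
have := card_polyhedral_gt0 polG; case: #|` Gamma| => // n _.
rewrite mulnS PoszD addrA addr_ge0 // abszE.
by rewrite -lerBlDl sub0r -normrN ler_norm.
Qed.

(** The numerator of [x] is divisible by the product of the ground forms, so
    that [x / P_k] has only a power of [P] as its denominator. *)
Lemma invariant_part_even (h : int) x : invariant_part Gamma P (h * 2) x ->
  exists2 r, invariant_part Gamma P 0 r & x = r * P_elt Gamma So nu Po P (h * 2).
Proof.
move=> [[f [m [d [e [fd Pe deg xE]]]]] xi].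
have [f0|f0] := eqVneq f 0.
  exists 0; first exact: invariant_part0.
  by rewrite xE f0 tofrac0 !mul0r.
have {}Pe := P_pow_homog Pe; rewrite {}Pe in deg.
have [s fs ss] := divisor_exists f0 fd; rewrite -ss in deg.
have cnt := counts_of_invariant polG hS hP_deg hP_inv hP_zero fs deg.
rewrite -xE in cnt; have {}cnt := cnt xi.
have Qs := ground_product_divisor (h * 2).
have le := ground_divisor_le fs.1 cnt.
have [q [u [qu su fE]]] := divisor_dvd Qs fs le.
have {su} sE := perm_size su; rewrite size_cat in sE.
have [a [b [deg' PE]]] := P_elt_frac h.
set Q := ground_product _ in fE PE Qs.
have Q0 : Q != 0 := has_divisor_neq0 Qs.
have rE : x = (q * P ^+ b)%:F / (P ^+ (m + a))%:F * P_elt Gamma So nu Po P (h * 2).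
  rewrite xE PE fE -tofrac_divM; apply: frac_eq; rewrite ?mulf_neq0 ?expf_neq0 //.
  by rewrite exprD; ring.
exists ((q * P ^+ b)%:F / (P ^+ (m + a))%:F) => //; split.
  exists (q * P ^+ b), (m + a)%N, (size u + b * #|` Gamma|)%N,
    ((m + a) * #|` Gamma|)%N; split=> //.
  - by rewrite dhomogM ?(has_divisor_homog qu) // mulnC dhomogMn.
  - by rewrite mulnC dhomogMn.
  have uE : (size u)%:Z = h * 2 + (m * #|` Gamma|)%:Z - (size (ground_divisor (h * 2)))%:Z.
    move: deg; rewrite sE PoszD; move: (size (ground_divisor _)) => N <-; ring.
  rewrite mulnDl !PoszD; move: uE deg'.
  by move: (size (ground_divisor (h * 2))) => N -> ->; ring.
move=> g gB; have gU : g \in unitmx by case/andP: gB => /SU2_unit.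
have := xi g gB; rewrite rE frac_actM // (P_elt_invariant h).2 //.
exact/mulIf/P_elt_neq0.
Qed.

Lemma act_N1 d (f : form) : f \is d.-homog -> act (- 1%:M) f = (-1) ^+ d *: f.
Proof.
have [->|f0 fd] := eqVneq f 0; first by rewrite /act rmorph0 scaler0.
have [s [ss [c c0 ->]] <-] := divisor_exists f0 fd.
rewrite actZ scalerA mulrC -scalerA; congr (_ *: _).
elim: s {ss} => [|p s IH]; first by rewrite /root_form big_nil act1 scale1r.
rewrite root_form_cons act_mul IH act_lform ?SU2N ?SU2_1 // mulNmx mul1mx.
by rewrite -scaleN1r lformZ exprS -scalerAr -scalerAl scalerA mulrC.
Qed.

Lemma N1_binary : - 1%:M \is binary Gamma.
Proof.
apply/andP; rewrite SU2N ?SU2_1 // SU2_to_SO3_N1; split=> //.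
exact: polyhedral1.
Qed.

(** Here [-1] belongs to the binary group and acts by [-1]. *)
Lemma invariant_part_odd k x : ~~ (2 %| k)%Z -> invariant_part Gamma P k x -> x = 0.
Proof.
move=> k2 [[f [m [d [e [fd Pe deg xE]]]]] /(_ _ N1_binary)].
have NU : (- 1%:M : 'M[C]_2) \in unitmx by rewrite SU2_unit ?SU2N ?SU2_1.
rewrite xE (frac_act_frac _ NU (expf_neq0 m P0)) (act_N1 fd) (act_N1 Pe) => /eqP.
have sg n : (-1) ^+ n != 0 :> C by rewrite expf_neq0 // oppr_eq0 oner_eq0.
have Pm0 := expf_neq0 m P0.
rewrite eqr_div ?tofrac_eq0 ?scaler_eq0 ?negb_or ?sg //.
rewrite -!tofracM tofrac_eq -scalerAl -scalerAr -subr_eq0 -scalerBl scaler_eq0.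
case/orP=> [sgE|]; last first.
  by rewrite mulf_eq0 (negPf Pm0) orbF => /eqP->; rewrite tofrac0 mul0r.
case/negP: k2; rewrite -deg; move: sgE.
rewrite -signr_odd -[in X in _ - X]signr_odd => sgE.
have {sgE} : odd d = odd e.
  move: sgE; case: (odd d); case: (odd e) => //; rewrite ?expr0 ?expr1.
    by rewrite -opprD oppr_eq0 -mulr2n pnatr_eq0.
  by rewrite opprK -mulr2n pnatr_eq0.
move=> oE; rewrite -(odd_double_half d) -(odd_double_half e) oE !PoszD opprD addrACA subrr add0r.
by rewrite -!muln2 !PoszM -mulrBl; apply/dvdzP; exists (d./2%:Z - e./2%:Z).
Qed.

End GroundForms.

Unset Implicit Arguments.

Theorem theorem2p4 (R : realType) (Gamma : {fset 'M[R]_3})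
    (hGamma : polyhedral Gamma)
    (* the exceptional orbits, the orders of their stabilisers and their
       ground forms *)
    (Omega : finType) (So : Omega -> {fset 'cV[R]_3}) (nu : Omega -> nat)
    (Po : Omega -> {mpoly R[i][2]})
    (hSo_inj : injective So)
    (hSo : forall T, is_exceptional_orbit Gamma T <-> exists i, T = So i)
    (hnu : forall i x, x \in So i -> #|` stabiliser Gamma x| = nu i)
    (hPo : forall i, is_ground_form (So i) (Po i))
    (S : {fset 'cV[R]_3}) (hS : is_orbit Gamma S)
    (P : {mpoly R[i][2]})
    (hP_deg : P \is #|` Gamma|.-homog)
    (hP_inv : relatively_invariant Gamma P)
    (hP_zero : has_zero_set S P) :
  forall k : int,
    (* the exponent of P in P_k is an integer *)
    ((2 %| k)%Z -> (#|` Gamma|%:Z %| residual_degree So nu k)%Z) /\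
    (forall x : {fraction {mpoly R[i][2]}},
       invariant_part Gamma P k x <->
       exists2 r, invariant_part Gamma P 0 r
                & x = r * P_elt Gamma So nu Po P k).
Proof.
move=> k; split; first exact: (residual_degree_dvd hGamma hSo_inj hSo hnu).
move=> x; have [/dvdzP[h ->]|k_odd] := boolP (2 %| k)%Z.
  split=> [|[r r_inv ->]]; first exact:
    (invariant_part_even hGamma hSo_inj hSo hnu hPo hS hP_deg hP_inv hP_zero).
  have P_inv := P_elt_invariant hGamma hSo_inj hSo hnu hPo hS hP_deg hP_inv hP_zero h.
  by have := invariant_partM r_inv P_inv; rewrite add0r.
rewrite /P_elt (negPf k_odd).
split=> [/(invariant_part_odd hGamma hP_zero k_odd)->|[r _ ->]].
  by exists 0; rewrite ?mulr0 //; exact: invariant_part0.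
by rewrite mulr0; exact: invariant_part0.
Qed.
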